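(* Let $H\in\mathbb{C}^{N_R\times N_S}$ and $G\in\mathbb{C}^{N_D\times N_R}$ have singular value decompositions $H=U_H\Lambda_H^{1/2}V_H^H$ and $G=U_G\Lambda_G^{1/2}V_G^H$. Consider the problem of maximizing, over Hermitian positive semidefinite $Q\in\mathbb{C}^{N_S\times N_S}$ and over $A\in\mathbb{C}^{N_R\times N_R}$, the ratio $$\frac{\log\left|I_{N_D}+W^{-1/2}GAHQH^HA^HG^HW^{-1/2}\right|}{\mathrm{tr}(Q)+\mathrm{tr}\left(A(HQH^H+\sigma_R^2I_{N_R})A^H\right)+P_c},\qquad W=\sigma_D^2I_{N_D}+\sigma_R^2GAA^HG^H,$$ subject to $$\log\left|I_{N_D}+W^{-1/2}GAHQH^HA^HG^HW^{-1/2}\right|\ge R_S^{min},\quad \mathrm{tr}(Q)\le P_S^{max},\quad \mathrm{tr}\left(A(HQH^H+\sigma_R^2I_{N_R})A^H\right)\le P_R^{max}.$$ Write the eigenvalue decomposition of $Q$ as $Q=U_Q\Lambda_QU_Q^H$ and the singular value decomposition of $A$ as $A=U_A\Lambda_A^{1/2}V_A^H$. Then the optimal $Q$ and $A$ are such that $U_Q=V_H$, $U_A=V_G$, and $V_A=U_H$.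
   Context: $|\cdot|$ is the determinant, $(\cdot)^H$ the conjugate transpose, $\mathrm{tr}$ the trace, $I_n$ the $n\times n$ identity. The constants $\sigma_R^2,\sigma_D^2$ (noise variances), $P_c$ (circuit power), $P_S^{max},P_R^{max}$ (maximum powers) are positive, and $R_S^{min}\ge 0$ is a minimum rate. In all eigenvalue and singular value decompositions (of $H$, $G$, $Q$ and $A$), the eigenvalues and singular values are arranged in decreasing order; $U_H,V_H,U_G,V_G,U_Q,U_A,V_A$ are unitary, and $\Lambda_H^{1/2},\Lambda_G^{1/2},\Lambda_Q,\Lambda_A^{1/2}$ are (possibly rectangular) diagonal matrices with non-negative diagonal entries.
   Formalization: Proved: whenever the problem is feasible, some optimal pair has these unitary factors; the eigenvalues of Q and the singular values of A are not required to be in decreasing order (only those of H and G are), since with that ordering the claim is false. *)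

(* Defs.v *)
(* MathComp world (MathComp-Analysis): real numbers form a realType R, complex
   numbers are R[i]. *)
From HB Require Import structures.
From mathcomp Require Import all_boot all_order all_algebra.
From mathcomp Require Import spectral sesquilinear.
From mathcomp Require Import complex.
From mathcomp Require Import all_classical all_reals all_analysis.

Set Implicit Arguments.
Unset Strict Implicit.
Unset Printing Implicit Defensive.

Import Order.TTheory GRing.Theory Num.Theory.

Local Open Scope ring_scope.
Local Open Scope complex_scope.
Local Open Scope sesquilinear_scope.

Section Matrices.
Variable C : numClosedFieldType.

(* The order of C makes [0 <= z] mean "z is real and nonnegative". *)
Definition psdmx n (M : 'M[C]_n) : Prop :=
  M \is hermsymmx /\ forall u : 'rV[C]_n, 0 <= (u *m M *m u ^t*) 0 0.

(* W^{-1/2}, by functional calculus on the spectral decomposition; meaningful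
   when W is normal and invertible. *)
Definition inv_sqrtmx n (W : 'M[C]_n) : 'M[C]_n :=
  invmx (spectralmx W)
    *m diag_mx (map_mx (fun x => (sqrtC x)^-1) (spectral_diag W))
    *m spectralmx W.

Lemma inv_sqrtmx_sqr n (W : 'M[C]_n) : W \is normalmx -> W \in unitmx ->
  inv_sqrtmx W *m inv_sqrtmx W = invmx W.
Proof.
move=> Wn Wu; rewrite /inv_sqrtmx.
have /orthomx_spectralP WE := Wn.
set P := spectralmx W in WE *; set d := spectral_diag W in WE *.
have Pu : P \in unitmx := spectral_unit W.
rewrite !mulmxA mulmxK // -[X in X *m P]mulmxA.
set e := map_mx _ d.
have dN0 i : d 0 i != 0.
  have : diag_mx d \in unitmx.
    by move: Wu; rewrite WE !unitmx_mul unitmx_inv Pu /= andbT.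
  rewrite unitmxE det_diag unitfE => /prodf_neq0; exact.
apply: (can_inj (mulKmx Wu)); rewrite mulmxV //.
rewrite [X in X *m _]WE !mulmxA mulmxK // -!mulmxA.
rewrite [diag_mx d *m _]mulmxA mulmx_diag [X in invmx P *m X]mulmxA mulmx_diag.
suff -> : diag_mx (\row_j ((\row_j (d 0 j * e 0 j)) 0 j * e 0 j)) = 1%:M.
  by rewrite mul1mx mulVmx.
apply/matrixP => i j; rewrite !mxE.
by case: eqP => // _; rewrite !mulr1n -mulrA -invfM -expr2 sqrtCK mulfV.
Qed.

Lemma inv_sqrtmx_psd n (W : 'M[C]_n) : psdmx W -> psdmx (inv_sqrtmx W).
Proof.
move=> [Wh Wp].
have /orthomx_spectralP WE := hermitian_normalmx Wh.
rewrite /inv_sqrtmx.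
set P := spectralmx W in WE *; set d := spectral_diag W in WE *.
have PU : P \is unitarymx := spectral_unitarymx W.
rewrite (invmx_unitary PU) in WE *.
set e := map_mx _ d.
have d_ge0 i : 0 <= d 0 i.
  have -> : d 0 i = (P *m W *m P ^t*) i i.
    by rewrite WE !mulmxA (unitarymxP PU) mul1mx mulmxtVK // !mxE eqxx.
  have := Wp (row i P); rewrite -row_mul !mxE.
  by under eq_bigr do rewrite !mxE; under [X in _ -> _ <= X]eq_bigr do rewrite !mxE.
have e_ge0 i : 0 <= e 0 i by rewrite mxE invr_ge0 sqrtC_ge0.
split.
  apply/is_hermitianmxP; rewrite expr0 scale1r !trmx_mul !map_mxM /=.
  rewrite trmxCK tr_diag_mx map_diag_mx mulmxA.
  congr (_ *m diag_mx _ *m _); apply/rowP => i.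
  by rewrite [RHS]mxE; apply/esym/conj_Creal; rewrite ger0_real.
move=> u; rewrite !mulmxA.
set v := u *m P ^t*.
have -> : v *m diag_mx e *m P *m u ^t* = v *m diag_mx e *m v ^t*.
  by rewrite /v trmx_mul map_mxM /= trmxCK !mulmxA.
rewrite mul_mx_diag mxE sumr_ge0 // => j _; rewrite !mxE.
by rewrite mulrAC mulr_ge0 ?mul_conjC_ge0 // invr_ge0 sqrtC_ge0.
Qed.

Definition nonneg_diag m n (L : 'M[C]_(m, n)) : Prop :=
  is_diag_mx L /\ forall i j, 0 <= L i j.

Definition decreasing_diag m n (L : 'M[C]_(m, n)) : Prop :=
  forall (i i' : 'I_m) (j j' : 'I_n),
    i = j :> nat -> i' = j' :> nat -> (i <= i')%N -> L i' j' <= L i j.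

(* L holds the singular values themselves (it is the matrix Lambda^{1/2}).
   Ordering is the separate predicate [decreasing_diag]: it fixes how the modes
   of two channels are paired, and a power allocation over modes that are
   already ordered by their channel gains need not itself be monotone. *)
Definition is_svd m n (M : 'M[C]_(m, n))
    (U : 'M[C]_m) (L : 'M[C]_(m, n)) (V : 'M[C]_n) : Prop :=
  [/\ U \is unitarymx, V \is unitarymx, nonneg_diag L & M = U *m L *m V ^t*].

Definition is_evd n (M U L : 'M[C]_n) : Prop :=
  [/\ U \is unitarymx, nonneg_diag L & M = U *m L *m U ^t*].

End Matrices.

Section RelayProblem.
Variables (R : realType) (NS NR ND : nat).
Variables (H : 'M[R[i]]_(NR, NS)) (G : 'M[R[i]]_(ND, NR)).
Variables (sR2 sD2 Pc Rmin PSmax PRmax : R).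
Implicit Types (Q : 'M[R[i]]_NS) (A : 'M[R[i]]_NR).

Definition noise_cov A : 'M[R[i]]_ND :=
  sD2%:C%:M + sR2%:C *: (G *m A *m A ^t* *m G ^t*).

(* The determinant and the traces below are real on the domain psdmx Q (and
   for positive noise variances); [complex.Re] only changes their type. *)
Definition rate Q A : R :=
  ln (complex.Re (\det (1%:M +
    inv_sqrtmx (noise_cov A) *m G *m A *m H *m Q *m H ^t* *m A ^t* *m G ^t*
      *m inv_sqrtmx (noise_cov A)))).

Definition source_power Q : R := complex.Re (\tr Q).

Definition relay_power Q A : R :=
  complex.Re (\tr (A *m (H *m Q *m H ^t* + sR2%:C%:M) *m A ^t*)).

Definition energy_efficiency Q A : R :=
  rate Q A / (source_power Q + relay_power Q A + Pc).

Definition feasible Q A : Prop :=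
  [/\ psdmx Q, Rmin <= rate Q A, source_power Q <= PSmax
    & relay_power Q A <= PRmax].

Definition optimal Q A : Prop :=
  feasible Q A /\
  forall Q' A', feasible Q' A' -> energy_efficiency Q' A' <= energy_efficiency Q A.

End RelayProblem.

(* Main.v *)
(* The rate is the logarithm of
     det (I + c G A Y A^* G^* ) / det (I + c r G A A^* G^* ),  Y = H Q H^* + r I,
   with r = sR2 and c = 1/sD2, so that the singular vectors of H and G can be
   absorbed into Q and A and both channels assumed diagonal, with gains h_i and
   k_i.  Let x_i be the eigenvalues of H Q H^*, y_i = x_i + r those of Y, and
   s_i those of K A Y A^* K, K = diag k, all in decreasing order.  The numerator
   is prod_i (1 + c s_i), and Fiedler's inequality
   det (M + N) >= prod_i (m_i + n_i) bounds the denominator below by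
   prod_i (1 + c r s_i / y_i).  The trace inequality
   sum_i w_i M_ii >= sum_i w_i m_i for increasing weights w gives
   tr Q >= sum_i x_i / h_i^2 and tr (A Y A^* ) >= sum_i s_i / k_i^2.  All four
   bounds are attained by the diagonal Q and A with Q_ii = x_i / h_i^2 and
   A_ii^2 = s_i / (k_i^2 y_i).  Over diagonal matrices the feasible set is
   compact, so that the maximum is attained. *)
Require Import Defs.
From HB Require Import structures.
From mathcomp Require Import all_boot all_order all_algebra.
From mathcomp Require Import fingroup perm.
From mathcomp Require Import spectral sesquilinear.
From mathcomp Require Import complex ring lra.
From mathcomp Require Import all_classical all_reals all_analysis.

Set Implicit Arguments.
Unset Strict Implicit.
Unset Printing Implicit Defensive.

Import Order.TTheory GRing.Theory Num.Theory.
Import numFieldNormedType.Exports.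

Local Open Scope ring_scope.
Local Open Scope complex_scope.
Local Open Scope sesquilinear_scope.

(** * Sylvester's determinant identity *)

Section Determinants.
Variable K : comNzRingType.

(** Schur complement of the identity block: a unitriangular column operation clears [B]. *)
Lemma det_block_scalar m n (x : K) (A : 'M[K]_(m, n)) (B : 'M[K]_(n, m)) :
  \det (block_mx x%:M A B 1%:M) = \det (x%:M - A *m B).
Proof.
have E : block_mx x%:M A B 1%:M *m block_mx 1%:M 0 (- B) 1%:M
         = block_mx (x%:M - A *m B) A 0 1%:M.
  by rewrite mulmx_block !mulmx1 !mulmx0 !mul1mx mulmxN addrC subrr !add0r addrC.
have := congr1 determinant E.
by rewrite det_mulmx det_lblock det_ublock !det1 !mulr1.
Qed.

(** Sylvester's identity, obtained by eliminating the block matrix in the other order. Keeping the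
    powers of [x] on both sides avoids division, so that [x] may later be the indeterminate of a
    polynomial ring. *)
Lemma det_scalar_sub_mulmxC m n (x : K) (A : 'M[K]_(m, n)) (B : 'M[K]_(n, m)) :
  x ^+ n * \det (x%:M - A *m B) = x ^+ m * \det (x%:M - B *m A).
Proof.
rewrite -det_block_scalar.
have E : block_mx x%:M A B 1%:M *m block_mx 1%:M (- A) 0 x%:M
         = block_mx x%:M 0 B (x%:M - B *m A).
  rewrite mulmx_block !mulmx1 !mulmx0 !mul1mx !addr0 !mulmxN mul_scalar_mx.
  by rewrite mul_mx_scalar addNr addrC.
have := congr1 determinant E.
by rewrite det_mulmx det_ublock det_lblock det1 mul1r !det_scalar mulrC.
Qed.

Lemma det_add1_mulmxC m n (A : 'M[K]_(m, n)) (B : 'M[K]_(n, m)) :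
  \det (1%:M + A *m B) = \det (1%:M + B *m A).
Proof.
have := det_scalar_sub_mulmxC 1 A (- B).
by rewrite !expr1n !mul1r mulmxN mulNmx !opprK.
Qed.

End Determinants.

(** * Rearrangement inequality for doubly stochastic weights *)

Section Rearrangement.
Variable C : numDomainType.

(* Linear programming duality: F i and w j * a j - F j, with F the discrete
   integral of a against dw, are potentials for the transport problem with cost
   w i * a j, tight on the diagonal. *)
Lemma doubly_stochastic_rearrangement n (w a : 'I_n -> C) (P : 'I_n -> 'I_n -> C) :
  {homo w : i j / (i <= j)%N >-> i <= j} ->
  {homo a : i j / (i <= j)%N >-> j <= i} ->
  (forall i j, 0 <= P i j) ->
  (forall i, \sum_j P i j = 1) -> (forall j, \sum_i P i j = 1) ->
  \sum_i w i * a i <= \sum_i \sum_j w i * P i j * a j.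
Proof.
case: n w a P => [|n] w a P w_incr a_decr P_ge0 Pr Pc; first by rewrite !big_ord0.
(* Extension to natural indices, so that the increments [v k.+1 - v k] can be written. *)
pose v k : C := w (inord k); pose b k : C := a (inord k).
pose F i := \sum_(k < i) (v k.+1 - v k) * b k.
have vP (i : 'I_n.+1) : w i = v i by rewrite /v inord_val.
have bP (i : 'I_n.+1) : a i = b i by rewrite /b inord_val.
have v_incr i j : (i <= j < n.+1)%N -> v i <= v j.
  move=> /andP[ij jn]; apply: w_incr; rewrite !inordK //; exact: leq_ltn_trans jn.
have b_decr i j : (i <= j < n.+1)%N -> b j <= b i.
  move=> /andP[ij jn]; apply: a_decr; rewrite !inordK //; exact: leq_ltn_trans jn.
(* The increment of [F] from [i] to [i + d] is a sum of increments of [v] weighted by values of [b],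
   all lying between [b (i + d)] and [b i]. *)
have F_gap i d : (i + d < n.+1)%N ->
    (F (i + d)%N - F i <= (v (i + d)%N - v i) * b i) /\
    ((v (i + d)%N - v i) * b (i + d)%N <= F (i + d)%N - F i).
  elim: d => [|d IH] idn; first by rewrite addn0 !subrr !mul0r.
  have idn' : (i + d < n.+1)%N by apply: leq_trans idn; rewrite addnS.
  have FS : F (i + d.+1)%N = F (i + d)%N + (v (i + d).+1 - v (i + d)%N) * b (i + d)%N.
    by rewrite addnS /F big_ord_recr.
  have dv : 0 <= v (i + d).+1 - v (i + d)%N.
    by rewrite subr_ge0 v_incr // leqnSn -addnS.
  have [IH1 IH2] := IH idn'; rewrite FS addnS -addrA [_ * b (i + d)%N - _]addrC addrA.
  have E x : (v (i + d).+1 - v i) * x =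
      (v (i + d)%N - v i) * x + (v (i + d).+1 - v (i + d)%N) * x.
    by rewrite -mulrDl [_ - v i + _]addrC addrA subrK.
  split; rewrite E; apply: lerD => //.
  - by rewrite ler_wpM2l // b_decr // leq_addr.
  - apply: le_trans IH2; apply: ler_wpM2l.
      by rewrite subr_ge0 v_incr // leq_addr.
    by rewrite b_decr // leqnSn -addnS.
  - by rewrite ler_wpM2l // b_decr // leqnSn -addnS.
have potential (i j : 'I_n.+1) : F i + (w j * a j - F j) <= w i * a j.
  rewrite !vP bP; case: (leqP i j) => [ij | /ltnW ji].
    have := @F_gap i (j - i)%N; rewrite subnKC // => /(_ (ltn_ord j))[_].
    rewrite -subr_ge0 => gap; rewrite -subr_ge0; congr (0 <= _): gap; ring.
  have := @F_gap j (i - j)%N; rewrite subnKC // => /(_ (ltn_ord i))[+ _].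
  by rewrite -subr_ge0 => gap; rewrite -subr_ge0; congr (0 <= _): gap; ring.
(* Since all marginals of [P] are 1, the potentials integrate to the diagonal cost whatever [P] is:
   the contributions of [F] cancel. *)
have -> : \sum_i w i * a i = \sum_i \sum_j P i j * (F i + (w j * a j - F j)).
  under [RHS]eq_bigr => i _ do
    (under eq_bigr do rewrite mulrDr; rewrite big_split -mulr_suml Pr mul1r).
  rewrite big_split exchange_big /=.
  under [X in _ = _ + X]eq_bigr do rewrite -mulr_suml Pc mul1r.
  by rewrite -big_split; apply: eq_bigr => i _ /=; rewrite addrC subrK.
apply: ler_sum => i _; apply: ler_sum => j _.
by rewrite [w i * _]mulrC -mulrA ler_wpM2l.
Qed.

End Rearrangement.

(** * Positive semidefinite matrices and ordered spectral decompositions *)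

Section Spectral.
Variable C : numClosedFieldType.

Let ge_trans : transitive (>=%R : rel C).
Proof. by move=> x y z yx xz; exact: le_trans xz yx. Qed.

Definition nonincreasing n (d : 'rV[C]_n) : Prop :=
  {homo (fun i : 'I_n => d 0 i) : i j / (i <= j)%N >-> j <= i}.

Lemma trmxC_mul m n p (A : 'M[C]_(m, n)) (B : 'M[C]_(n, p)) :
  (A *m B) ^t* = B ^t* *m A ^t*.
Proof. by rewrite trmx_mul map_mxM. Qed.

Lemma unitary_mulVmx n (U : 'M[C]_n) : U \is unitarymx -> U ^t* *m U = 1%:M.
Proof. by move=> UU; rewrite -(invmx_unitary UU) mulVmx ?unitarymx_unit. Qed.

Lemma det_unitary_conj n (U M : 'M[C]_n) : U \is unitarymx ->
  \det (U *m M *m U ^t*) = \det M.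
Proof.
move=> UU; rewrite !det_mulmx mulrAC -det_mulmx (unitarymxP UU) det1.
by rewrite mul1r.
Qed.

Lemma conj_diag_ge0 n (d : 'rV[C]_n) : (forall i, 0 <= d 0 i) ->
  (diag_mx d) ^t* = diag_mx d.
Proof.
move=> d_ge0; rewrite tr_diag_mx map_diag_mx; congr diag_mx; apply/rowP => i.
by rewrite !mxE; apply: conj_Creal; rewrite ger0_real.
Qed.

Lemma psdmx_hermitian n (M : 'M[C]_n) : psdmx M -> M ^t* = M.
Proof. by case=> /is_hermitianmxP; rewrite expr0 scale1r => <-. Qed.

Lemma psdmx_conj m n (B : 'M[C]_(m, n)) (M : 'M[C]_n) :
  psdmx M -> psdmx (B *m M *m B ^t*).
Proof.
move=> Mp; split; last first.
  by move=> u; have := Mp.2 (u *m B); rewrite trmxC_mul !mulmxA.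
apply/is_hermitianmxP; rewrite expr0 scale1r !trmxC_mul trmxCK.
by rewrite (psdmx_hermitian Mp) mulmxA.
Qed.

Lemma psdmxD n (M N : 'M[C]_n) : psdmx M -> psdmx N -> psdmx (M + N).
Proof.
move=> Mp Np; split; last first.
  by move=> u; rewrite mulmxDr mulmxDl mxE addr_ge0 //; [apply: Mp.2 | apply: Np.2].
apply/is_hermitianmxP; rewrite expr0 scale1r linearD map_mxD /=.
by rewrite (psdmx_hermitian Mp) (psdmx_hermitian Np).
Qed.

Lemma psdmx_diag n (d : 'rV[C]_n) : (forall i, 0 <= d 0 i) -> psdmx (diag_mx d).
Proof.
move=> d_ge0; split.
  by apply/is_hermitianmxP; rewrite expr0 scale1r conj_diag_ge0.
move=> u; rewrite mul_mx_diag mxE sumr_ge0 // => j _; rewrite !mxE.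
by rewrite mulrAC mulr_ge0 // mul_conjC_ge0.
Qed.

Lemma psdmx_scalar n (a : C) : 0 <= a -> psdmx (a%:M : 'M[C]_n).
Proof.
by move=> a_ge0; rewrite -diag_const_mx; apply: psdmx_diag => i; rewrite mxE.
Qed.

Lemma psdmx_gram m n (B : 'M[C]_(m, n)) : psdmx (B *m B ^t*).
Proof. by have := psdmx_conj B (psdmx_scalar n ler01); rewrite mulmx1. Qed.

Lemma psdmx_diag_ge0 n (M : 'M[C]_n) i : psdmx M -> 0 <= M i i.
Proof.
move=> [_ /(_ (delta_mx 0 i))]; rewrite -rowE.
rewrite mxE (bigD1 i) //= !mxE !eqxx conjC1 mulr1 big1 ?addr0 //.
by move=> j /negPf ji; rewrite !mxE eqxx ji conjC0 mulr0.
Qed.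

(** The spectral theorem gives the eigenvalues in arbitrary order; they are sorted, and the sorting
    permutation is absorbed into the unitary factor. *)
Lemma psdmx_spectral n (M : 'M[C]_n) : psdmx M ->
  exists (U : 'M[C]_n) (d : 'rV[C]_n),
  [/\ U \is unitarymx, nonincreasing d, forall i, 0 <= d 0 i
    & M = U *m diag_mx d *m U ^t*].
Proof.
move=> Mp; have [Mh _] := Mp.
have /orthomx_spectralP := hermitian_normalmx Mh.
set P := spectralmx M; set e := spectral_diag M => ME.
have PU : P \is unitarymx := spectral_unitarymx M.
rewrite (invmx_unitary PU) in ME.
have e_ge0 i : 0 <= e 0 i.
  have -> : e 0 i = (P *m M *m P ^t*) i i.
    by rewrite ME !mulmxA (unitarymxP PU) mul1mx mulmxtVK // !mxE eqxx.
  exact/psdmx_diag_ge0/psdmx_conj.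
pose s := [tuple of sort >=%R [tuple e 0 i | i < n]].
have s_sorted : sorted >=%R s.
  (* The order of [C] is total only between real elements, hence the restriction to the nonnegative
     ones. *)
  apply: (@sort_sorted_in _ [pred x : C | 0 <= x]).
    by move=> x y /ger0_real xr /ger0_real yr; exact: real_leVge.
  by apply/allP => x /mapP[i _ ->]; exact: e_ge0.
have /tuple_permP[p sE] : perm_eq s [tuple e 0 i | i < n] by rewrite /= perm_sort.
have sp i : tnth s i = e 0 (p i).
  by rewrite (tnth_nth 0) sE -[LHS](tnth_nth 0) !tnth_mktuple.
have permC : (perm_mx p : 'M[C]_n) ^t* = perm_mx p^-1.
  by rewrite tr_perm_mx map_perm_mx.
exists ((perm_mx p *m P) ^t*), (\row_i tnth s i); split.
- rewrite trmxC_unitary mul_unitarymx //.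
  by apply/unitarymxP; rewrite permC -perm_mxM mulgV perm_mx1.
- move=> i j ij; rewrite !mxE !(tnth_nth 0).
  by apply: (sorted_leq_nth ge_trans (@lexx _ C) 0 s_sorted); rewrite ?inE ?size_tuple.
- by move=> i; rewrite mxE sp.
- rewrite trmxCK trmxC_mul permC [LHS]ME !mulmxA; congr (_ *m P).
  rewrite -!mulmxA; congr (_ *m _); apply/matrixP => i j.
  rewrite mulmxA -row_permE -[p]invgK -col_permE !mxE !invgK sp permKV.
  by rewrite (inj_eq (@perm_inj _ p^-1)).
Qed.

End Spectral.

(** * Trace and determinant inequalities for eigenvalues *)

Section Inequalities.
Variable C : numClosedFieldType.

Lemma sum_row_unitary n (U : 'M[C]_n) i : U \is unitarymx ->
  \sum_j `|U i j| ^+ 2 = 1.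
Proof.
move=> /unitarymxP UU; transitivity ((U *m U ^t*) i i); last by rewrite UU mxE eqxx.
by rewrite mxE; apply: eq_bigr => j _; rewrite !mxE normCK.
Qed.

Lemma sum_col_unitary n (U : 'M[C]_n) j : U \is unitarymx ->
  \sum_i `|U i j| ^+ 2 = 1.
Proof.
rewrite -trmx_unitary => /(sum_row_unitary j) <-.
by apply: eq_bigr => i _; rewrite mxE.
Qed.

Lemma diag_evd n (U : 'M[C]_n) (d : 'rV[C]_n) i :
  (U *m diag_mx d *m U ^t*) i i = \sum_j `|U i j| ^+ 2 * d 0 j.
Proof.
rewrite mul_mx_diag mxE; apply: eq_bigr => j _.
by rewrite !mxE normCK mulrAC.
Qed.

(** The squared moduli of the entries of [U] form a doubly stochastic matrix that maps the spectrum
    [d] to the diagonal, so the rearrangement inequality applies. *)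
Lemma weighted_eigenvalues_le n (U : 'M[C]_n) (d : 'rV[C]_n) (w : 'I_n -> C) :
  U \is unitarymx -> nonincreasing d -> {homo w : i j / (i <= j)%N >-> i <= j} ->
  \sum_i w i * d 0 i <= \sum_i w i * (U *m diag_mx d *m U ^t*) i i.
Proof.
move=> UU d_decr w_incr.
apply: le_trans (_ : \sum_i \sum_j w i * `|U i j| ^+ 2 * d 0 j <= _).
  apply: doubly_stochastic_rearrangement;
    [exact: w_incr | exact: d_decr | move=> i j | move=> i | move=> j].
  - by rewrite exprn_ge0.
  - exact: sum_row_unitary.
  - exact: sum_col_unitary.
apply: ler_sum => i _.
by rewrite diag_evd mulr_sumr; apply: ler_sum => j _; rewrite -mulrA lexx.
Qed.

(* Diagonalize the sum with increasing inverse eigenvalues w: by the weighted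
   trace bound applied to both terms, sum_i w_i (a_i + b_i) <= n, and AM-GM
   turns this into a bound on prod_i w_i (a_i + b_i). *)
Lemma prod_eigenvalues_le_det_add n (U V : 'M[C]_n) (a b : 'rV[C]_n) :
  U \is unitarymx -> V \is unitarymx -> nonincreasing a -> nonincreasing b ->
  (forall i, 0 < a 0 i) -> (forall i, 0 <= b 0 i) ->
  \prod_i (a 0 i + b 0 i) <=
    \det (U *m diag_mx a *m U ^t* + V *m diag_mx b *m V ^t*).
Proof.
move=> UU VU a_decr b_decr a_gt0 b_ge0.
set M := _ + _.
have Mp : psdmx M.
  by apply: psdmxD; apply/psdmx_conj/psdmx_diag => // i; exact: ltW.
have [W [l [WU l_decr l_ge0 ME]]] := psdmx_spectral Mp.
have WWU : W ^t* \is unitarymx by rewrite trmxC_unitary.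
have WtU (X : 'M[C]_n) : X \is unitarymx -> W ^t* *m X \is unitarymx.
  exact: mul_unitarymx.
have lE i : l 0 i = (W ^t* *m U *m diag_mx a *m (W ^t* *m U) ^t*) i i
                  + (W ^t* *m V *m diag_mx b *m (W ^t* *m V) ^t*) i i.
  rewrite !trmxC_mul trmxCK.
  transitivity ((W ^t* *m M *m W) i i); last first.
    by rewrite mulmxDr mulmxDl !mulmxA mxE.
  rewrite ME !mulmxA unitary_mulVmx // mul1mx -mulmxA unitary_mulVmx //.
  by rewrite mulmx1 !mxE eqxx.
(* Positivity makes the inverse weights below meaningful: since [a] is positive, a zero eigenvalue
   would force a whole row of a unitary matrix to vanish. *)
have l_gt0 i : 0 < l 0 i.
  have term_ge0 (X : 'M[C]_n) (c : 'rV[C]_n) (c_ge0 : forall j, 0 <= c 0 j) j :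
    0 <= `|X i j| ^+ 2 * c 0 j by rewrite mulr_ge0 ?exprn_ge0.
  have a_ge0 j : 0 <= a 0 j by exact: ltW.
  rewrite lE !diag_evd; apply: ltr_wpDr; first by apply: sumr_ge0 => j _; exact: term_ge0.
  rewrite lt0r sumr_ge0 ?andbT => [|j _]; last exact: term_ge0.
  apply/negP; rewrite psumr_eq0 => [/allP P0|j _]; last exact: term_ge0.
  have /eqP := sum_row_unitary i (WtU _ UU).
  rewrite big1 1?eq_sym ?oner_eq0 // => j _.
  have := P0 j (mem_index_enum j).
  by rewrite /= mulf_eq0 (gt_eqF (a_gt0 j)) orbF => /eqP.
pose w i := (l 0 i)^-1.
have w_incr : {homo w : i j / (i <= j)%N >-> i <= j}.
  by move=> i j ij; rewrite lef_pV2 ?posrE ?l_gt0 // l_decr.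
have w_sum : \sum_i w i * (a 0 i + b 0 i) <= #|'I_n|%:R.
  under eq_bigr do rewrite mulrDr.
  rewrite big_split /=.
  have := lerD (weighted_eigenvalues_le (WtU _ UU) a_decr w_incr)
               (weighted_eigenvalues_le (WtU _ VU) b_decr w_incr).
  move=> /le_trans; apply; rewrite -big_split /=.
  under eq_bigr do rewrite -mulrDr -lE /w mulVf ?gt_eqF //.
  by rewrite sumr_const.
have E_ge0 i : 0 <= w i * (a 0 i + b 0 i).
  by rewrite mulr_ge0 ?invr_ge0 ?addr_ge0 // ltW.
have w_prod : \prod_i (w i * (a 0 i + b 0 i)) <= 1.
  have [+ _] := @leif_AGM _ 'I_n predT (fun i => w i * (a 0 i + b 0 i)) (fun i _ => E_ge0 i).
  move=> /le_trans; apply; rewrite exprn_ile1 //.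
    by rewrite divr_ge0 ?ler0n // sumr_ge0.
  have [n0|n0] := posnP #|'I_n|; first by rewrite n0 invr0 mulr0 ler01.
  by rewrite ler_pdivrMr ?ltr0n // mul1r.
have -> : \det M = \prod_i l 0 i by rewrite ME det_unitary_conj // det_diag.
rewrite -[leRHS]mulr1 -ler_pdivrMl ?prodr_gt0 // -prodfV -big_split //=.
Qed.

(** Sylvester's identity at the indeterminate, where the factor ['X ^+ n] can be cancelled. *)
Lemma char_poly_mulmxC n (A B : 'M[C]_n) :
  char_poly (A *m B) = char_poly (B *m A).
Proof.
rewrite /char_poly /char_poly_mx !map_mxM.
apply: (@mulfI _ ('X ^+ n)); first by rewrite expf_neq0 // polyX_eq0.
exact: det_scalar_sub_mulmxC.
Qed.

Lemma char_poly_evd n (U : 'M[C]_n) (d : 'rV[C]_n) : U \is unitarymx ->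
  char_poly (U *m diag_mx d *m U ^t*) = \prod_i ('X - (d 0 i)%:P).
Proof.
move=> UU; rewrite -mulmxA char_poly_mulmxC -mulmxA unitary_mulVmx // mulmx1.
rewrite char_poly_trig ?diag_mx_is_trig //.
by apply: eq_bigr => i _; rewrite mxE eqxx.
Qed.

(** Both Gram matrices have the same characteristic polynomial, hence the same multiset of roots,
    and sorting leaves only one way to list it. *)
Lemma evd_gram_swap n (M U V : 'M[C]_n) (d e : 'rV[C]_n) :
  U \is unitarymx -> V \is unitarymx -> nonincreasing d -> nonincreasing e ->
  M *m M ^t* = U *m diag_mx d *m U ^t* ->
  M ^t* *m M = V *m diag_mx e *m V ^t* -> d = e.
Proof.
move=> UU VU d_decr e_decr ME1 ME2.
have := char_poly_mulmxC M (M ^t*); rewrite ME1 ME2 !char_poly_evd //.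
have E (f : 'rV[C]_n) :
    \prod_i ('X - (f 0 i)%:P) = \prod_(x <- [seq f 0 i | i : 'I_n]) ('X - x%:P).
  by rewrite big_image.
rewrite !E => /prod_XsubC_eq de.
have ge_trans : transitive (>=%R : rel C).
  by move=> x y z yx xz; exact: le_trans xz yx.
have ge_anti : antisymmetric (>=%R : rel C) by move=> x y; rewrite andbC; exact: le_anti.
have srt (f : 'rV[C]_n) : nonincreasing f -> sorted >=%R [seq f 0 i | i : 'I_n].
  move=> f_decr; rewrite sorted_map.
  have : sorted leq [seq val i | i <- enum 'I_n] by rewrite val_enum_ord iota_sorted.
  by rewrite sorted_map; apply: sub_sorted => i j; exact: f_decr.
have /eq_in_map/= de' := sorted_eq ge_trans ge_anti (srt _ d_decr) (srt _ e_decr) de.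
by apply/rowP => i; apply: de'; rewrite mem_enum.
Qed.

(** The weights [1 / h_i] increase along the positive [h_i], but the convention [0^-1 = 0] breaks
    monotonicity on dead modes. There the weight is replaced by an arbitrarily large one, which
    costs nothing on the right because [M i i = 0]; letting it grow forces [x_i = 0] on the left. *)
Lemma evd_inverse_weights n (U : 'M[C]_n) (h x : 'rV[C]_n) (M := U *m diag_mx x *m U ^t*) :
  U \is unitarymx -> nonincreasing x -> (forall i, 0 <= x 0 i) ->
  nonincreasing h -> (forall i, 0 <= h 0 i) ->
  (forall i, h 0 i = 0 -> M i i = 0) ->
  (forall i, h 0 i = 0 -> x 0 i = 0) /\
  \sum_i x 0 i * (h 0 i)^-1 <= \sum_i M i i * (h 0 i)^-1.
Proof.
move=> UU x_decr x_ge0 h_decr h_ge0 M0.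
have Mp : psdmx M by apply/psdmx_conj/psdmx_diag.
have M_ge0 i : 0 <= M i i by exact: psdmx_diag_ge0.
pose S := \sum_i (h 0 i)^-1; pose T := \sum_i M i i * (h 0 i)^-1.
have S_ge i : (h 0 i)^-1 <= S.
  by rewrite /S (bigD1 i) //= lerDl sumr_ge0 // => j _; rewrite invr_ge0.
have T_ge0 : 0 <= T by rewrite sumr_ge0 // => i _; rewrite mulr_ge0 ?invr_ge0.
(* [S] dominates every [1 / h_i], so [w t] is increasing for each [t >= 0]. *)
pose w t i := if h 0 i == 0 then S + t else (h 0 i)^-1.
have w_ge0 t i : 0 <= t -> 0 <= w t i.
  rewrite /w; case: ifP => _ t0; rewrite ?invr_ge0 // addr_ge0 // sumr_ge0 // => j _.
  by rewrite invr_ge0.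
have wle t : 0 <= t -> \sum_i w t i * x 0 i <= T.
  move=> t0; have w_incr : {homo w t : i j / (i <= j)%N >-> i <= j}.
    move=> i j ij; rewrite /w; have hij := h_decr _ _ ij; case: eqP => [hi|/eqP hi].
      by rewrite hi in hij; rewrite (@le_anti _ _ (h 0 j) 0) ?eqxx // hij h_ge0.
    case: eqP => [_|/eqP hj]; first by rewrite (le_trans (S_ge i)) // lerDl.
    by rewrite lef_pV2 // posrE lt0r ?hi ?hj h_ge0.
  apply: le_trans (weighted_eigenvalues_le UU x_decr w_incr) _.
  apply: ler_sum => i _; rewrite -/M /w; case: eqP => [/M0->|_]; first by rewrite mulr0 mul0r.
  by rewrite mulrC.
have x0 i : h 0 i = 0 -> x 0 i = 0.
  move=> hi; apply/eqP/negPn/negP => xi.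
  have xi_gt0 : 0 < x 0 i by rewrite lt0r xi x_ge0.
  (* With this [t] the single term at [i] is already at least [T + 1], while the whole sum is at
     most [T]. *)
  have t0 : 0 <= (T + 1) / x 0 i by rewrite divr_ge0 ?addr_ge0.
  have : T + 1 <= T; last by rewrite gerDl ler10.
  apply: le_trans (wle _ t0); rewrite (bigD1 i) //= {1}/w hi eqxx mulrDl divfK //.
  rewrite addrAC lerDr addr_ge0 //.
    by rewrite mulr_ge0 // sumr_ge0 // => j _; rewrite invr_ge0.
  by rewrite sumr_ge0 // => j _; rewrite mulr_ge0 // w_ge0.
split=> //; apply: le_trans (wle 0 (lexx _)); apply: ler_sum => i _.
rewrite /w; case: eqP => [/x0->|_]; first by rewrite mul0r mulr0.
by rewrite mulrC.
Qed.

End Inequalities.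

(** * Bound on the determinant ratio for a diagonal second hop *)

Section RateBound.
Variable C : numClosedFieldType.

Lemma det_add1_evd n (U : 'M[C]_n) (c : C) (d : 'rV[C]_n) : U \is unitarymx ->
  \det (1%:M + c *: (U *m diag_mx d *m U ^t*)) = \prod_i (1 + c * d 0 i).
Proof.
move=> UU.
have -> : 1%:M + c *: (U *m diag_mx d *m U ^t*) =
    U *m diag_mx (\row_i (1 + c * d 0 i)) *m U ^t*.
  have -> : diag_mx (\row_i (1 + c * d 0 i)) = 1%:M + c *: diag_mx d.
    by apply/matrixP => i j; rewrite !mxE; case: eqP; rewrite ?mulr1n ?mulr0n ?mulr0 ?addr0.
  by rewrite mulmxDr mulmxDl mulmx1 (unitarymxP UU) -scalemxAr -scalemxAl.
by rewrite det_unitary_conj // det_diag; apply: eq_bigr => i _; rewrite mxE.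
Qed.

(** With [M = diag k A U sqrt y], the numerator is a determinant in [M M^*] and the denominator one
    in [M y^-1 M^*]. Cycling the latter product and multiplying by [det y] gives
    [det (y + c sg M^* M)], to which Fiedler's inequality applies. *)
Lemma relay_gain_bound n (U A : 'M[C]_n) (k x : 'rV[C]_n) (c sg : C)
    (X := U *m diag_mx x *m U ^t*) (Y := X + sg%:M) :
  U \is unitarymx -> nonincreasing x -> (forall i, 0 <= x 0 i) ->
  nonincreasing k -> (forall i, 0 <= k 0 i) -> 0 < c -> 0 < sg ->
  let num := \det (1%:M + c *: (diag_mx k *m A *m Y *m A ^t* *m diag_mx k)) in
  let den := \det (1%:M + (c * sg) *: (diag_mx k *m A *m A ^t* *m diag_mx k)) in
  exists al : 'I_n -> C,
  [/\ forall i, 0 <= al i,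
      \sum_i al i * (x 0 i + sg) <= \tr (A *m Y *m A ^t*),
      0 < num / den
    & num / den <= \prod_i ((1 + c * k 0 i ^+ 2 * al i * (x 0 i + sg)) /
                            (1 + c * sg * k 0 i ^+ 2 * al i))].
Proof.
move=> UU x_decr x_ge0 k_decr k_ge0 c_gt0 sg_gt0 num den.
pose y : 'rV[C]_n := \row_i (x 0 i + sg).
have y_gt0 i : 0 < y 0 i by rewrite mxE ltr_wpDl.
have y_decr : nonincreasing y by move=> i j ij; rewrite !mxE lerD2r x_decr.
have YE : Y = U *m diag_mx y *m U ^t*.
  have -> : diag_mx y = diag_mx x + sg%:M.
    by apply/matrixP => i j; rewrite !mxE; case: eqP => _; rewrite ?mulr1n ?mulr0n ?addr0.
  rewrite mulmxDr mulmxDl mul_mx_scalar -scalemxAl (unitarymxP UU).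
  by rewrite scalemx1.
pose D := diag_mx (\row_i sqrtC (y 0 i)).
have DC : D ^t* = D by apply: conj_diag_ge0 => i; rewrite mxE sqrtC_ge0 ltW.
have DD : D *m D = diag_mx y.
  rewrite mulmx_diag; congr diag_mx; apply/rowP => i; rewrite !mxE -expr2.
  by rewrite sqrtCK.
pose N := diag_mx k *m A *m U.
pose M := N *m D.
have kC : (diag_mx k) ^t* = diag_mx k by exact: conj_diag_ge0.
have NC : N ^t* = U ^t* *m A ^t* *m diag_mx k.
  by rewrite /N !trmxC_mul kC mulmxA.
have MM : M *m M ^t* = diag_mx k *m (A *m Y *m A ^t*) *m diag_mx k.
  rewrite /M trmxC_mul DC NC YE /N -DD !mulmxA //.
have MiM : M *m diag_mx (\row_i (y 0 i)^-1) *m M ^t* =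
    diag_mx k *m A *m A ^t* *m diag_mx k.
  have DiD : D *m diag_mx (\row_i (y 0 i)^-1) *m D = 1%:M.
    rewrite !mulmx_diag -diag_const_mx; congr diag_mx; apply/rowP => i; rewrite !mxE.
    by rewrite mulrAC -expr2 sqrtCK mulfV // gt_eqF //; move: (y_gt0 i); rewrite mxE.
  rewrite /M trmxC_mul DC NC /N -!mulmxA.
  rewrite [D *m (_ *m (D *m _))]mulmxA [D *m _ *m (D *m _)]mulmxA DiD mul1mx.
  by rewrite [U *m (U ^t* *m _)]mulmxA (unitarymxP UU) mul1mx !mulmxA.
(* The numerator sees [M M^*] and the denominator sees [M^* M]; their ordered spectra agree, so [s]
   serves both. *)
have [P [s [PU s_decr s_ge0 PE]]] := psdmx_spectral (psdmx_gram M).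
have [V [e [VU e_decr e_ge0]]] := psdmx_spectral (psdmx_gram (M ^t*)).
rewrite trmxCK => VE.
have {e e_decr e_ge0 VE} VE : M ^t* *m M = V *m diag_mx s *m V ^t*.
  by rewrite (evd_gram_swap PU VU s_decr e_decr PE VE).
have numE : num = \prod_i (1 + c * s 0 i).
  by rewrite -(det_add1_evd _ _ PU) -PE MM !mulmxA.
(* Fiedler's lower bound for [den], divided by [det y]. *)
pose D0 := \prod_i ((y 0 i + c * sg * s 0 i) / y 0 i).
have csg : 0 < c * sg by rewrite mulr_gt0.
have D0_gt0 : 0 < D0.
  by apply: prodr_gt0 => i _; rewrite divr_gt0 // ltr_wpDr // mulr_ge0 // ltW.
have den_ge : D0 <= den.
  have yprod : 0 < \prod_i y 0 i by apply: prodr_gt0.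
  rewrite /D0 prodf_div ler_pdivrMr // /den -MiM -mulmxA scalemxAl det_add1_mulmxC.
  rewrite [leRHS]mulrC -det_diag -det_mulmx mulmxDr mulmx1 !mulmxA mulmx_diag.
  have -> : diag_mx (\row_j (y 0 j * (\row_i (y 0 i)^-1) 0 j)) = 1%:M.
    rewrite -diag_const_mx; congr diag_mx; apply/rowP => i.
    by rewrite [LHS]mxE [X in _ * X]mxE mulfV ?gt_eqF // mxE.
  rewrite mul1mx -scalemxAr VE.
  have := @prod_eigenvalues_le_det_add _ n 1%:M V y ((c * sg) *: s).
  rewrite trmx1 map_mx1 mulmx1 mul1mx.
  have -> : diag_mx ((c * sg) *: s) = (c * sg) *: diag_mx s by rewrite linearZ.
  rewrite -scalemxAr -scalemxAl.
  under eq_bigr do rewrite [X in _ + X]mxE.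
  apply=> //; first by apply/unitarymxP; rewrite trmx1 map_mx1 mulmx1.
    by move=> i j ij; rewrite !mxE ler_wpM2l ?s_decr // ltW.
  by move=> i; rewrite mxE mulr_ge0 // ltW.
have den_gt0 : 0 < den by exact: lt_le_trans den_ge.
have num_gt0 : 0 < num.
  by rewrite numE prodr_gt0 // => i _; rewrite ltr_wpDr // mulr_ge0 // ltW.
(* The second-hop power gains, which scale the diagonal of [A Y A^*] into that of [M M^*]; hence the
   inverse weights in the trace bound. *)
pose h : 'rV[C]_n := \row_i k 0 i ^+ 2.
have MME i : (M *m M ^t*) i i = h 0 i * (A *m Y *m A ^t*) i i.
  by rewrite MM mul_mx_diag mxE mul_diag_mx mxE [h 0 i]mxE expr2 mulrAC.
have [] := @evd_inverse_weights _ _ P h s PU s_decr s_ge0.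
- by move=> i j ij; rewrite !mxE lerXn2r ?nnegrE ?k_decr.
- by move=> i; rewrite mxE exprn_ge0.
- by move=> i hi; rewrite -PE MME hi mul0r.
rewrite -PE => s0 s_sum.
have Yp : psdmx (A *m Y *m A ^t*).
  by rewrite YE; apply/psdmx_conj/psdmx_conj/psdmx_diag => i; rewrite ltW.
(* The squared relay gain that gives mode [i] the output [s_i]; it is 0 on dead modes, where [s0]
   shows that nothing is lost. *)
exists (fun i => s 0 i / h 0 i / y 0 i); split.
- move=> i; rewrite !mulr_ge0 ?invr_ge0 // ?(ltW (y_gt0 i)) //.
  by rewrite mxE exprn_ge0.
- have E i : s 0 i / h 0 i / y 0 i * (x 0 i + sg) = s 0 i / h 0 i.
    have -> : x 0 i + sg = y 0 i by rewrite mxE.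
    by rewrite divfK // gt_eqF.
  under eq_bigr do rewrite E.
  apply: le_trans s_sum _; apply: ler_sum => i _; rewrite MME mulrAC.
  have [->|h0] := eqVneq (h 0 i) 0; first by rewrite !mul0r psdmx_diag_ge0.
  by rewrite mulfV // mul1r.
- by rewrite divr_gt0.
apply: le_trans (_ : num / D0 <= _).
  by rewrite ler_pM2l // lef_pV2.
rewrite numE /D0 -prodf_div le_eqVlt; apply/orP; left; apply/eqP.
apply: eq_bigr => i _.
have -> : x 0 i + sg = y 0 i by rewrite mxE.
have -> : k 0 i ^+ 2 = h 0 i by rewrite mxE.
have y0 : y 0 i != 0 by rewrite gt_eqF.
have E : h 0 i * (s 0 i / h 0 i / y 0 i) = s 0 i / y 0 i.
  have [h0|h0] := eqVneq (h 0 i) 0; first by rewrite h0 (s0 _ h0) !mul0r.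
  by rewrite mulrA [h 0 i * _]mulrC divfK.
rewrite -![c * h 0 i * _]mulrA -![c * sg * h 0 i * _]mulrA !E -[c * _ * y 0 i]mulrA divfK //.
generalize (y 0 i) (s 0 i) y0 (y_gt0 i) (s_ge0 i) => yi si yi0 yi_gt0 si_ge0.
field; rewrite yi0 /= gt_eqF // ltr_wpDr // mulr_ge0 // ltW //.
Qed.

End RateBound.

(** * Reduction of rectangular diagonal channels to scalar modes *)

Section DiagonalChannels.
Variable C : numClosedFieldType.

Lemma nonneg_diag_rowP m n (L : 'M[C]_(m, n)) (i : 'I_m) : nonneg_diag L ->
  (exists2 j : 'I_n, i = j :> nat & forall j', j' != j -> L i j' = 0) \/
  ((n <= i)%N /\ forall j, L i j = 0).
Proof.
move=> [/is_diag_mxP Ld _]; have [i_lt|i_ge] := ltnP i n; [left|right].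
  exists (Ordinal i_lt) => // j; rewrite -val_eqE /= => ji; apply: Ld.
  by rewrite eq_sym.
split=> // j; apply: Ld; rewrite gtn_eqF //; exact: leq_trans i_ge.
Qed.

Lemma nonneg_diag_tr m n (L : 'M[C]_(m, n)) : nonneg_diag L -> nonneg_diag L^T.
Proof.
move=> [/is_diag_mxP Ld L_ge0]; split=> [|i j]; last by rewrite mxE.
by apply/is_diag_mxP => i j ij; rewrite mxE Ld // eq_sym.
Qed.

Lemma decreasing_diag_tr m n (L : 'M[C]_(m, n)) :
  decreasing_diag L -> decreasing_diag L^T.
Proof.
by move=> Ld i i' j j' ij ij' ii'; rewrite !mxE; apply: Ld => //; rewrite -ij -ij'.
Qed.

(** A row sum reads off the diagonal entry of the row, or 0 when the row lies beyond the last
    column. This gives a full list of singular values padded by zeros, whatever the shape of [L]. *)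
Lemma row_sum_nonincreasing m n (L : 'M[C]_(m, n)) :
  nonneg_diag L -> decreasing_diag L -> nonincreasing (\row_i \sum_j L i j).
Proof.
move=> Ld L_decr i i' ii'; rewrite !mxE.
have [[j' ij' L0']|[_ L0']] := nonneg_diag_rowP i' Ld; last first.
  by rewrite big1 // sumr_ge0 // => j _; exact: Ld.2.
rewrite (bigD1 j') //= big1 ?addr0; last by move=> j /L0'.
have [[j ij L0]|[ni _]] := nonneg_diag_rowP i Ld; last first.
  by have := leq_trans ni ii'; rewrite ij' leqNgt ltn_ord.
rewrite [leRHS](bigD1 j) //= big1 ?addr0; last by move=> j0 /L0.
exact: L_decr.
Qed.

(** At most one entry of the row is nonzero. Since [0^-1 = 0], inverse squares are among the
    admissible [f]. *)
Lemma row_sum_fun m n (L : 'M[C]_(m, n)) (f : C -> C) i : nonneg_diag L -> f 0 = 0 ->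
  \sum_j f (L i j) = f (\sum_j L i j).
Proof.
move=> Ld f0; have [[j _ L0]|[_ L0]] := nonneg_diag_rowP i Ld.
  rewrite (bigD1 j) //= big1 ?addr0 => [|j' /L0 ->//].
  by rewrite [in RHS](bigD1 j) //= big1 ?addr0 => [|j' /L0].
by rewrite big1 => [|j _]; rewrite ?L0 // big1.
Qed.

Lemma conj_nonneg_diag m n (L : 'M[C]_(m, n)) : nonneg_diag L -> L ^t* = L^T.
Proof.
move=> [_ L_ge0]; apply/matrixP => i j; rewrite !mxE.
by apply: conj_Creal; rewrite ger0_real.
Qed.

Lemma nonneg_diag_conj_diag m n (L : 'M[C]_(m, n)) (q : 'rV[C]_n) : nonneg_diag L ->
  L *m diag_mx q *m L ^t* = diag_mx (\row_i \sum_j L i j ^+ 2 * q 0 j).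
Proof.
move=> Ld; rewrite conj_nonneg_diag //; have [/is_diag_mxP L0 _] := Ld.
apply/matrixP => i i'; rewrite mul_mx_diag !mxE.
have [->|ii'] := eqVneq i i'.
  by rewrite mulr1n; apply: eq_bigr => j _; rewrite !mxE expr2 mulrAC.
rewrite mulr0n big1 // => j _; rewrite !mxE.
have [ij|ij] := eqVneq (i : nat) j; last by rewrite L0 // !mul0r.
by rewrite [L i' j]L0 ?mulr0 // -ij eq_sym.
Qed.

Lemma gram_nonneg_diag m n (L : 'M[C]_(m, n)) : nonneg_diag L ->
  L ^t* *m L = diag_mx (\row_i \sum_j L j i) *m diag_mx (\row_i \sum_j L j i).
Proof.
move=> Ld; have Ldt := nonneg_diag_tr Ld.
have := @nonneg_diag_conj_diag _ _ _ (const_mx 1) Ldt.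
rewrite diag_const_mx mulmx1 (conj_nonneg_diag Ldt) trmxK (conj_nonneg_diag Ld) => ->.
rewrite mulmx_diag; congr diag_mx; apply/rowP => i; rewrite !mxE.
under eq_bigr do rewrite [const_mx _ _ _]mxE mulr1.
rewrite (@row_sum_fun _ _ _ (fun z => z ^+ 2)) // ?expr0n // expr2.
by congr (_ * _); apply: eq_bigr => j _; rewrite mxE.
Qed.

(** After a cyclic move both sides depend on the channel only through [L^* L], the square of [k]; a
    rectangular channel may thus be replaced by a square diagonal one. *)
Lemma det_add1_nonneg_diag m n (L : 'M[C]_(m, n)) (c : C) (Z : 'M[C]_n)
    (k := diag_mx (\row_i \sum_j L j i)) : nonneg_diag L ->
  \det (1%:M + c *: (L *m Z *m L ^t*)) = \det (1%:M + c *: (k *m Z *m k)).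
Proof.
move=> Ld; rewrite !scalemxAr !(det_add1_mulmxC (_ *m Z)) -!scalemxAl.
by rewrite !mulmxA gram_nonneg_diag.
Qed.

(** The diagonal of [L Q L^*] is that of [Q] scaled by the channel power gains, so the
    inverse-weight trace bound compares the power needed to produce the spectrum [x] over separate
    modes with the trace of [Q]. *)
Lemma source_bound m n (L : 'M[C]_(m, n)) (Q : 'M[C]_n) :
  nonneg_diag L -> decreasing_diag L -> psdmx Q ->
  exists (U : 'M[C]_m) (q : 'I_n -> C) (x := \row_i \sum_j L i j ^+ 2 * q j),
  [/\ U \is unitarymx, forall j, 0 <= q j, nonincreasing x,
      L *m Q *m L ^t* = U *m diag_mx x *m U ^t*
    & \sum_j q j <= \tr Q].
Proof.
move=> Ld L_decr Qp; have [/is_diag_mxP L0 L_ge0] := Ld.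
have [U [x [UU x_decr x_ge0 XE]]] := psdmx_spectral (psdmx_conj L Qp).
pose h : 'rV[C]_m := \row_i (\sum_j L i j) ^+ 2.
have h_ge0 i : 0 <= h 0 i by rewrite mxE exprn_ge0 // sumr_ge0.
have h_decr : nonincreasing h.
  move=> i j ij; have := row_sum_nonincreasing Ld L_decr ij; rewrite !mxE => le_ij.
  by rewrite lerXn2r // nnegrE sumr_ge0.
have hE i : h 0 i = \sum_j L i j ^+ 2.
  by rewrite (@row_sum_fun _ _ _ (fun z => z ^+ 2)) ?expr0n // mxE.
have hVE i : (h 0 i)^-1 = \sum_j (L i j ^+ 2)^-1.
  by rewrite (@row_sum_fun _ _ _ (fun z => (z ^+ 2)^-1)) ?expr0n ?invr0 // mxE.
have XiiE i : (L *m Q *m L ^t*) i i = \sum_j L i j ^+ 2 * Q j j.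
  rewrite conj_nonneg_diag // mxE; apply: eq_bigr => j _; rewrite !mxE.
  have [ij|ij] := eqVneq (i : nat) j; last by rewrite L0 // mulr0 expr0n mul0r.
  rewrite (bigD1 j) //= big1 ?addr0 => [|j' jj']; first by rewrite mulrAC expr2.
  by rewrite L0 ?mul0r // ij eq_sym.
have [] := evd_inverse_weights UU x_decr x_ge0 h_decr h_ge0.
  move=> i hi; rewrite -XE XiiE big1 // => j _.
  have : h 0 i == 0 by rewrite hi.
  rewrite hE psumr_eq0 => [|j' _]; last by rewrite exprn_ge0.
  by move=> /allP/(_ j (mem_index_enum j))/= /eqP->; rewrite mul0r.
rewrite -XE => x0 x_sum.
(* At most one term is nonzero: [q_j] is [x_j] over the squared singular value, and 0 on dead or
   missing modes. *)
pose q j := \sum_i (L i j ^+ 2)^-1 * x 0 i.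
have xE : (\row_i \sum_j L i j ^+ 2 * q j) = x.
  apply/rowP => i; rewrite mxE.
  have [[j ij Li]|[_ Li]] := nonneg_diag_rowP i Ld; last first.
    rewrite big1 => [|j _]; last by rewrite Li expr0n mul0r.
    by rewrite x0 // hE big1 // => j _; rewrite Li expr0n.
  rewrite (bigD1 j) //= big1 ?addr0 => [|j' /Li ->]; last by rewrite expr0n mul0r.
  rewrite /q (bigD1 i) //= big1 ?addr0 => [|i' ii']; last first.
    by rewrite L0 ?expr0n ?invr0 ?mul0r // -ij.
  have [Lij|Lij] := eqVneq (L i j) 0; last by rewrite mulVKf // expf_neq0.
  rewrite Lij expr0n mul0r x0 // hE big1 // => j' _.
  by have [->|/Li ->] := eqVneq j' j; rewrite ?Lij expr0n.
exists U, q; split=> //=.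
- by move=> j; rewrite sumr_ge0 // => i _; rewrite mulr_ge0 // invr_ge0 exprn_ge0.
- by rewrite xE.
- by rewrite xE.
apply: le_trans (_ : \sum_i x 0 i * (h 0 i)^-1 <= _).
  rewrite /q exchange_big /=; apply: ler_sum => i _.
  by rewrite hVE mulr_sumr; apply: ler_sum => j _; rewrite mulrC.
apply: le_trans x_sum _.
under eq_bigr do rewrite XiiE mulr_suml.
rewrite exchange_big /=; apply: ler_sum => j _.
have Ldt := nonneg_diag_tr Ld.
have Qj : 0 <= Q j j by exact: psdmx_diag_ge0.
have [[i ji Lj]|[_ Lj]] := nonneg_diag_rowP j Ldt; last first.
  by rewrite big1 // => i _; have := Lj i; rewrite mxE => ->; rewrite expr0n !mul0r.
rewrite (bigD1 i) //= big1 ?addr0 => [|i' /Lj]; last first.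
  by rewrite mxE => ->; rewrite expr0n !mul0r.
(* It remains to see that the factor of [Q j j], a gain divided by itself or 0, is at most 1. *)
rewrite mulrAC ler_piMl //.
have [->|Lij] := eqVneq (L i j) 0; first by rewrite expr0n mul0r ler01.
have Lij_gt0 : 0 < L i j ^+ 2 by rewrite lt0r expf_neq0 // exprn_ge0.
have le_h : L i j ^+ 2 <= h 0 i.
  by rewrite hE (bigD1 j) //= lerDl sumr_ge0 // => j' _; rewrite exprn_ge0.
by rewrite ler_pdivrMr ?mul1r // (lt_le_trans Lij_gt0).
Qed.

(** The two hops are bounded in turn: the source bound supplies the spectrum of the received
    covariance, and its eigenvectors are the arbitrary [U] of [relay_gain_bound]. *)
Lemma diagonal_channel_bound m n p (LH : 'M[C]_(n, m)) (LG : 'M[C]_(p, n))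
    (Q : 'M[C]_m) (A : 'M[C]_n) (c sg : C)
    (Y := LH *m Q *m LH ^t* + sg%:M) (k := fun i => \sum_j LG j i)
    (num := \det (1%:M + c *: (LG *m A *m Y *m A ^t* *m LG ^t*)))
    (den := \det (1%:M + (c * sg) *: (LG *m A *m A ^t* *m LG ^t*))) :
  nonneg_diag LH -> decreasing_diag LH -> nonneg_diag LG -> decreasing_diag LG ->
  psdmx Q -> 0 < c -> 0 < sg ->
  exists (q : 'I_m -> C) (al : 'I_n -> C)
    (y := fun i => \sum_j LH i j ^+ 2 * q j + sg),
  [/\ (forall j, 0 <= q j) /\ (forall i, 0 <= al i),
      \sum_j q j <= \tr Q,
      \sum_i al i * y i <= \tr (A *m Y *m A ^t*),
      0 < num / den
    & num / den <= \prod_i ((1 + c * k i ^+ 2 * al i * y i) /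
                            (1 + c * sg * k i ^+ 2 * al i))].
Proof.
move=> LHd LH_decr LGd LG_decr Qp c_gt0 sg_gt0.
have [U [q [/= UU q_ge0 x_decr XE q_sum]]] := source_bound LHd LH_decr Qp.
have k_decr : nonincreasing (\row_i \sum_j LG j i).
  have := row_sum_nonincreasing (nonneg_diag_tr LGd) (decreasing_diag_tr LG_decr).
  move=> kd i j ij; have := kd i j ij; rewrite !mxE.
  by under eq_bigr do rewrite mxE; under [X in _ <= X -> _]eq_bigr do rewrite mxE.
set x := \row_i _ in x_decr XE.
have x_ge0 i : 0 <= x 0 i.
  by rewrite mxE sumr_ge0 // => j _; rewrite mulr_ge0 // exprn_ge0 // LHd.2.
have k_ge0 i : 0 <= (\row_i \sum_j LG j i) 0 i :> C.
  by rewrite mxE sumr_ge0 // => j _; exact: LGd.2.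
have [al [al_ge0 al_sum]] :=
  relay_gain_bound A UU x_decr x_ge0 k_decr k_ge0 c_gt0 sg_gt0.
have numE : num = \det (1%:M + c *: (diag_mx (\row_i \sum_j LG j i) *m A *m
    (U *m diag_mx x *m U ^t* + sg%:M) *m A ^t* *m diag_mx (\row_i \sum_j LG j i))).
  rewrite /num /Y XE; have := det_add1_nonneg_diag c
    (A *m (U *m diag_mx x *m U ^t* + sg%:M) *m A ^t*) LGd.
  by rewrite !mulmxA.
have denE : den = \det (1%:M + (c * sg) *: (diag_mx (\row_i \sum_j LG j i) *m A *m
    A ^t* *m diag_mx (\row_i \sum_j LG j i))).
  have := det_add1_nonneg_diag (c * sg) (A *m A ^t*) LGd.
  by rewrite !mulmxA.
rewrite -numE -denE => ratio_gt0 ratio_le.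
exists q, al; split=> //=.
  rewrite /Y XE; apply: le_trans al_sum.
  by apply: ler_sum => i _; rewrite mxE.
apply: le_trans ratio_le _; rewrite le_eqVlt; apply/orP; left; apply/eqP.
by apply: eq_bigr => i _; rewrite !mxE.
Qed.

End DiagonalChannels.

(** * The rate as a ratio of determinants without matrix square roots *)

Section WhitenedDeterminant.
Variable C : numClosedFieldType.

Lemma det_add1_unitary_conj n (U Z : 'M[C]_n) (c : C) : U \is unitarymx ->
  \det (1%:M + c *: (U *m Z *m U ^t*)) = \det (1%:M + c *: Z).
Proof.
move=> UU; rewrite -mulmxA scalemxAr det_add1_mulmxC -scalemxAl -mulmxA.
by rewrite unitary_mulVmx // mulmx1.
Qed.

Lemma psdmxZ n (M : 'M[C]_n) (a : C) : 0 <= a -> psdmx M -> psdmx (a *: M).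
Proof.
move=> a_ge0 Mp; have := psdmx_conj (sqrtC a)%:M Mp.
rewrite tr_scalar_mx map_scalar_mx mul_scalar_mx mul_mx_scalar scalerA /=.
by rewrite conj_Creal ?ger0_real ?sqrtC_ge0 // -expr2 sqrtCK.
Qed.

Lemma det_add1_psdmx_gt0 n (M : 'M[C]_n) (a : C) :
  0 <= a -> psdmx M -> 0 < \det (1%:M + a *: M).
Proof.
move=> a_ge0 /psdmx_spectral[U [d [UU _ d_ge0 ->]]].
by rewrite det_add1_evd // prodr_gt0 // => i _; rewrite ltr_wpDr // mulr_ge0.
Qed.

(** Determinant of the total covariance at the destination over that of the noise covariance, both
    normalized by the receiver noise [s]. *)
Definition sinr_ratio m n p (H : 'M[C]_(n, m)) (G : 'M[C]_(p, n)) (r s : C)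
    (Q : 'M[C]_m) (A : 'M[C]_n) : C :=
  \det (1%:M + s^-1 *: (G *m A *m (H *m Q *m H ^t* + r%:M) *m A ^t* *m G ^t*)) /
  \det (1%:M + (s^-1 * r) *: (G *m A *m A ^t* *m G ^t*)).

(** A cyclic move joins the two factors [S] into [W^-1], and
    [det (1 + M W^-1) = det (W + M) / det W]. In [W + M] the forwarded relay noise merges with the
    signal into [H Q H^* + r], and the powers of [s] cancel. *)
Lemma det_whitened m n p (G : 'M[C]_(p, n)) (A : 'M[C]_n) (H : 'M[C]_(n, m))
    (Q : 'M[C]_m) (r s : C) (S := inv_sqrtmx (s%:M + r *: (G *m A *m A ^t* *m G ^t*))) :
  0 < r -> 0 < s ->
  \det (1%:M + S *m G *m A *m H *m Q *m H ^t* *m A ^t* *m G ^t* *m S) =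
  sinr_ratio H G r s Q A.
Proof.
move=> r_gt0 s_gt0; rewrite {}/S /sinr_ratio.
set T := G *m A *m A ^t* *m G ^t*; set W := s%:M + _; set S := inv_sqrtmx W.
pose M := G *m A *m H *m Q *m H ^t* *m A ^t* *m G ^t*.
have s0 : s != 0 by rewrite gt_eqF.
have Tp : psdmx T.
  by have := psdmx_gram (G *m A); rewrite trmxC_mul !mulmxA.
have Wp : psdmx W.
  by apply: psdmxD; [apply: psdmx_scalar | apply: psdmxZ => //]; exact: ltW.
have WE : W = s *: (1%:M + (s^-1 * r) *: T).
  by rewrite scalerDr scalerA mulrA mulfV // mul1r scalemx1.
have den_gt0 : 0 < \det (1%:M + (s^-1 * r) *: T).
  by apply: det_add1_psdmx_gt0 => //; rewrite mulr_ge0 ?invr_ge0 // ltW.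
have detW : \det W = s ^+ p * \det (1%:M + (s^-1 * r) *: T) by rewrite WE detZ.
have Wu : W \in unitmx.
  by rewrite unitmxE unitfE detW mulf_neq0 ?expf_neq0 // gt_eqF.
have -> : S *m G *m A *m H *m Q *m H ^t* *m A ^t* *m G ^t* *m S = S *m (M *m S).
  by rewrite /M !mulmxA.
have SS : S *m S = invmx W by apply: inv_sqrtmx_sqr => //; apply/hermitian_normalmx/Wp.1.
rewrite det_add1_mulmxC -(mulmxA M) SS.
have -> : 1%:M + M *m invmx W = (W + M) *m invmx W by rewrite mulmxDl mulmxV.
have -> : W + M = s *: (1%:M + s^-1 *: (G *m A *m (H *m Q *m H ^t* + r%:M)
    *m A ^t* *m G ^t*)).
  rewrite scalerDr scalerA mulfV // scale1r scalemx1 mulmxDr !mulmxDl mul_mx_scalar.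
  by rewrite -!scalemxAl /W !mulmxA -addrA [_ *: _ + _]addrC.
by rewrite det_mulmx det_inv detW detZ -mulf_div mulfV ?mul1r // expf_neq0.
Qed.

End WhitenedDeterminant.

(** * Invariance under a change to the singular bases of the channels *)

Section UnitaryInvariance.
Variable C : numClosedFieldType.
Variables (NS NR ND : nat) (r : C).
Variables (UH : 'M[C]_NR) (LH : 'M[C]_(NR, NS)) (VH : 'M[C]_NS).
Variables (UG : 'M[C]_ND) (LG : 'M[C]_(ND, NR)) (VG : 'M[C]_NR).
Hypotheses (UHU : UH \is unitarymx) (VHU : VH \is unitarymx).
Hypotheses (UGU : UG \is unitarymx) (VGU : VG \is unitarymx).
Variables (Q : 'M[C]_NS) (A : 'M[C]_NR).
Let H := UH *m LH *m VH ^t*.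
Let G := UG *m LG *m VG ^t*.
Let Q' := VH *m Q *m VH ^t*.
Let A' := VG *m A *m UH ^t*.

Lemma mxtrace_unitary_conj n (U M : 'M[C]_n) : U \is unitarymx ->
  \tr (U *m M *m U ^t*) = \tr M.
Proof. by move=> UU; rewrite mxtrace_mulC mulmxA unitary_mulVmx // mul1mx. Qed.

Lemma received_cov_unitary : H *m Q' *m H ^t* + r%:M =
  UH *m (LH *m Q *m LH ^t* + r%:M) *m UH ^t*.
Proof.
rewrite mulmxDr mulmxDl mul_mx_scalar -scalemxAl (unitarymxP UHU) scalemx1.
rewrite /H /Q' !trmxC_mul trmxCK !mulmxA; congr (_ + _).
by rewrite -(mulmxA _ (VH ^t*) VH) unitary_mulVmx // mulmx1
           -(mulmxA _ (VH ^t*) VH) unitary_mulVmx // mulmx1.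
Qed.

(** A general [Z] covers both determinants: the received covariance for the numerator, the identity
    for the denominator. *)
Lemma relay_output_unitary (Z : 'M[C]_NR) :
  G *m A' *m (UH *m Z *m UH ^t*) *m A' ^t* *m G ^t* =
  UG *m (LG *m A *m Z *m A ^t* *m LG ^t*) *m UG ^t*.
Proof.
rewrite /G /A' !trmxC_mul !trmxCK !mulmxA.
by rewrite -!(mulmxA _ (VG ^t*) VG) -!(mulmxA _ (UH ^t*) UH) !unitary_mulVmx // !mulmx1.
Qed.

Lemma relay_cov_unitary (Z : 'M[C]_NR) :
  A' *m (UH *m Z *m UH ^t*) *m A' ^t* = VG *m (A *m Z *m A ^t*) *m VG ^t*.
Proof.
rewrite /A' !trmxC_mul !trmxCK !mulmxA.
by rewrite -!(mulmxA _ (UH ^t*) UH) !unitary_mulVmx // !mulmx1.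
Qed.

Lemma relay_signal_unitary :
  G *m A' *m (H *m Q' *m H ^t* + r%:M) *m A' ^t* *m G ^t* =
  UG *m (LG *m A *m (LH *m Q *m LH ^t* + r%:M) *m A ^t* *m LG ^t*) *m UG ^t*.
Proof. by rewrite received_cov_unitary relay_output_unitary. Qed.

Lemma relay_noise_unitary :
  G *m A' *m A' ^t* *m G ^t* = UG *m (LG *m A *m A ^t* *m LG ^t*) *m UG ^t*.
Proof.
have := relay_output_unitary 1%:M.
by rewrite !mulmx1 (unitarymxP UHU) mulmx1.
Qed.

Lemma mxtrace_relay_cov_unitary :
  \tr (A' *m (H *m Q' *m H ^t* + r%:M) *m A' ^t*) =
  \tr (A *m (LH *m Q *m LH ^t* + r%:M) *m A ^t*).
Proof. by rewrite received_cov_unitary relay_cov_unitary mxtrace_unitary_conj. Qed.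

Lemma sinr_ratio_unitary (s : C) : sinr_ratio H G r s Q' A' = sinr_ratio LH LG r s Q A.
Proof.
by rewrite /sinr_ratio relay_signal_unitary relay_noise_unitary !det_add1_unitary_conj.
Qed.

End UnitaryInvariance.

(** * Transfer of the invariance to the real rate and powers *)

Section Relay.
Variable R : realType.

Lemma ReK (z : R[i]) : 0 <= z -> (complex.Re z)%:C = z.
Proof. by move=> z_ge0; apply: RRe_real; rewrite ger0_real. Qed.

Lemma rateE NS NR ND (H : 'M[R[i]]_(NR, NS)) (G : 'M[R[i]]_(ND, NR)) (sR2 sD2 : R)
    (Q : 'M[R[i]]_NS) (A : 'M[R[i]]_NR) : 0 < sR2 -> 0 < sD2 ->
  rate H G sR2 sD2 Q A = ln (complex.Re (sinr_ratio H G sR2%:C sD2%:C Q A)).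
Proof.
move=> sR2_gt0 sD2_gt0; congr (ln (complex.Re _)).
by apply: det_whitened; rewrite ltcR.
Qed.

Section UnitaryReduction.
Variables (NS NR ND : nat) (sR2 sD2 : R).
Variables (UH : 'M[R[i]]_NR) (LH : 'M[R[i]]_(NR, NS)) (VH : 'M[R[i]]_NS).
Variables (UG : 'M[R[i]]_ND) (LG : 'M[R[i]]_(ND, NR)) (VG : 'M[R[i]]_NR).
Hypotheses (UHU : UH \is unitarymx) (VHU : VH \is unitarymx).
Hypotheses (UGU : UG \is unitarymx) (VGU : VG \is unitarymx).
Variables (Q : 'M[R[i]]_NS) (A : 'M[R[i]]_NR).

Lemma rate_unitary : 0 < sR2 -> 0 < sD2 ->
  rate (UH *m LH *m VH ^t*) (UG *m LG *m VG ^t*) sR2 sD2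
    (VH *m Q *m VH ^t*) (VG *m A *m UH ^t*) = rate LH LG sR2 sD2 Q A.
Proof.
move=> sR2_gt0 sD2_gt0.
have ratioE := sinr_ratio_unitary sR2%:C LH LG UHU VHU UGU VGU Q A sD2%:C.
etransitivity; first exact (rateE _ _ _ _ sR2_gt0 sD2_gt0).
etransitivity; last exact (esym (rateE LH LG Q A sR2_gt0 sD2_gt0)).
exact (congr1 (fun z => ln (complex.Re z)) ratioE).
Qed.

Lemma source_power_unitary : source_power (VH *m Q *m VH ^t*) = source_power Q.
Proof. by congr (complex.Re _); exact: mxtrace_unitary_conj. Qed.

Lemma relay_power_unitary :
  relay_power (UH *m LH *m VH ^t*) sR2 (VH *m Q *m VH ^t*) (VG *m A *m UH ^t*) =
  relay_power LH sR2 Q A.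
Proof.
congr (complex.Re _).
exact: (mxtrace_relay_cov_unitary sR2%:C LH UHU VHU VGU Q A).
Qed.

End UnitaryReduction.

End Relay.

(** * The determinant ratio at diagonal matrices *)

Section DiagonalRatio.
Variable C : numClosedFieldType.

Lemma det_add1_diag_conj n p (LG : 'M[C]_(p, n)) (z : 'rV[C]_n) (c : C) : nonneg_diag LG ->
  \det (1%:M + c *: (LG *m diag_mx z *m LG ^t*)) =
  \prod_i (1 + c * (\sum_j LG j i) ^+ 2 * z 0 i).
Proof.
move=> LGd; rewrite det_add1_nonneg_diag // !mulmx_diag.
set d := \row_j _.
have := @det_add1_evd _ _ 1%:M c d.
rewrite trmx1 map_mx1 mulmx1 mul1mx => ->; last first.
  by apply/unitarymxP; rewrite trmx1 map_mx1 mulmx1.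
by apply: eq_bigr => i _; rewrite !mxE; ring.
Qed.

Lemma received_cov_diag m n (LH : 'M[C]_(n, m)) (q : 'rV[C]_m) (r : C) : nonneg_diag LH ->
  LH *m diag_mx q *m LH ^t* + r%:M = diag_mx (\row_i (\sum_j LH i j ^+ 2 * q 0 j + r)).
Proof.
move=> LHd; rewrite nonneg_diag_conj_diag // -diag_const_mx -linearD.
by congr diag_mx; apply/rowP => i; rewrite !mxE.
Qed.

Lemma relay_cov_diag n (b y : 'rV[C]_n) : (forall i, 0 <= b 0 i) ->
  diag_mx b *m diag_mx y *m (diag_mx b) ^t* = diag_mx (\row_i (b 0 i ^+ 2 * y 0 i)).
Proof.
move=> b_ge0; rewrite conj_diag_ge0 // !mulmx_diag; congr diag_mx.
by apply/rowP => i; rewrite !mxE mulrAC expr2.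
Qed.

Lemma sinr_ratio_diag m n p (LH : 'M[C]_(n, m)) (LG : 'M[C]_(p, n)) (r s : C)
    (q : 'rV[C]_m) (b : 'rV[C]_n) :
  nonneg_diag LH -> nonneg_diag LG -> (forall i, 0 <= b 0 i) ->
  sinr_ratio LH LG r s (diag_mx q) (diag_mx b) =
  \prod_i ((1 + s^-1 * (\sum_j LG j i) ^+ 2 *
              (b 0 i ^+ 2 * (\sum_j LH i j ^+ 2 * q 0 j + r))) /
           (1 + s^-1 * r * (\sum_j LG j i) ^+ 2 * b 0 i ^+ 2)).
Proof.
move=> LHd LGd b_ge0; rewrite /sinr_ratio prodf_div; congr (_ / _).
  have -> : LG *m diag_mx b *m (LH *m diag_mx q *m LH ^t* + r%:M)
        *m (diag_mx b) ^t* *m LG ^t* =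
      LG *m (diag_mx b *m (LH *m diag_mx q *m LH ^t* + r%:M) *m (diag_mx b) ^t*) *m LG ^t*.
    by rewrite !mulmxA.
  rewrite received_cov_diag // relay_cov_diag // det_add1_diag_conj //.
  by apply: eq_bigr => i _; rewrite !mxE.
have := relay_cov_diag (const_mx 1) b_ge0; rewrite diag_const_mx mulmx1 => bE.
rewrite -(mulmxA LG) bE.
rewrite det_add1_diag_conj //; apply: eq_bigr => i _.
by rewrite !mxE mulr1.
Qed.

(** The upper bound has the form of the value in [sinr_ratio_diag] with [al] in place of the squares
    of [b], so square roots of [al] attain it. *)
Lemma sinr_ratio_le_diag m n p (LH : 'M[C]_(n, m)) (LG : 'M[C]_(p, n)) (r s : C)
    (Q : 'M[C]_m) (A : 'M[C]_n) :
  nonneg_diag LH -> decreasing_diag LH -> nonneg_diag LG -> decreasing_diag LG ->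
  psdmx Q -> 0 < r -> 0 < s ->
  exists (q : 'rV[C]_m) (al : 'rV[C]_n),
  [/\ (forall j, 0 <= q 0 j) /\ (forall i, 0 <= al 0 i),
      \sum_j q 0 j <= \tr Q,
      \sum_i al 0 i * (\sum_j LH i j ^+ 2 * q 0 j + r) <=
        \tr (A *m (LH *m Q *m LH ^t* + r%:M) *m A ^t*),
      0 < sinr_ratio LH LG r s Q A
    & sinr_ratio LH LG r s Q A <=
      \prod_i ((1 + s^-1 * (\sum_j LG j i) ^+ 2 *
              (al 0 i * (\sum_j LH i j ^+ 2 * q 0 j + r))) /
           (1 + s^-1 * r * (\sum_j LG j i) ^+ 2 * al 0 i))].
Proof.
move=> LHd LH_decr LGd LG_decr Qp r_gt0 s_gt0.
have sV_gt0 : 0 < s^-1 by rewrite invr_gt0.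
have [q [al [/= [q_ge0 al_ge0] q_sum al_sum ratio_gt0 ratio_le]]] :=
  diagonal_channel_bound A LHd LH_decr LGd LG_decr Qp sV_gt0 r_gt0.
have yE i : \sum_j LH i j ^+ 2 * (\row_j q j) 0 j = \sum_j LH i j ^+ 2 * q j.
  by apply: eq_bigr => j _; rewrite mxE.
exists (\row_j q j), (\row_i al i); split=> //.
- by split=> i; rewrite mxE.
- by under eq_bigr do rewrite mxE.
- by under eq_bigr do rewrite mxE yE.
apply: le_trans ratio_le _; rewrite le_eqVlt; apply/orP; left; apply/eqP.
by apply: eq_bigr => i _; rewrite mxE yE !mulrA.
Qed.

End DiagonalRatio.

(** * The scalar problem over mode amplitudes *)

Section DiagonalProblem.
Variables (R : realType) (NS NR ND : nat).
Variables (LH : 'M[R[i]]_(NR, NS)) (LG : 'M[R[i]]_(ND, NR)) (sR2 sD2 : R).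
Implicit Types (g : 'rV[R]_NS) (b : 'rV[R]_NR).

(* Q has eigenvalues g_j^2, rather than g_j, so that the functions mode_* are
   continuous on the whole space. *)
Definition source_mx g : 'M[R[i]]_NS := diag_mx (\row_j (g 0 j ^+ 2)%:C).
Definition relay_mx b : 'M[R[i]]_NR := diag_mx (\row_i (b 0 i)%:C).

(** Eigenvalue of the received covariance at the relay on mode [i]; the entries of [LH] are real,
    and [complex.Re] only changes their type. *)
Definition mode_cov g i : R := \sum_j complex.Re (LH i j) ^+ 2 * g 0 j ^+ 2 + sR2.

(** The squared [i]-th singular value of the second hop, or 0 when [i] exceeds its number of
    rows. *)
Definition mode_gain i : R := (\sum_j complex.Re (LG j i)) ^+ 2.

Definition mode_sinr g b : R :=
  \prod_i ((1 + sD2^-1 * mode_gain i * (b 0 i ^+ 2 * mode_cov g i)) /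
           (1 + sD2^-1 * sR2 * mode_gain i * b 0 i ^+ 2)).

Definition mode_source_power g : R := \sum_j g 0 j ^+ 2.
Definition mode_relay_power g b : R := \sum_i b 0 i ^+ 2 * mode_cov g i.

Hypotheses (sR2_gt0 : 0 < sR2) (sD2_gt0 : 0 < sD2).
Hypotheses (LHd : nonneg_diag LH) (LGd : nonneg_diag LG).

Lemma mode_covC g i :
  (mode_cov g i)%:C = \sum_j LH i j ^+ 2 * (g 0 j ^+ 2)%:C + sR2%:C.
Proof.
rewrite rmorphD rmorph_sum; congr (_ + _); apply: eq_bigr => j _.
by rewrite rmorphM [in LHS]rmorphXn /= ReK // LHd.2.
Qed.

Lemma mode_gainC i : (mode_gain i)%:C = (\sum_j LG j i) ^+ 2.
Proof.
rewrite /mode_gain rmorphXn rmorph_sum; congr (_ ^+ 2); apply: eq_bigr => j _.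
by rewrite /= ReK // LGd.2.
Qed.

Lemma mode_cov_gt0 g i : 0 < mode_cov g i.
Proof. by rewrite ltr_wpDl // sumr_ge0 // => j _; rewrite mulr_ge0 // sqr_ge0. Qed.

Lemma mode_gain_ge0 i : 0 <= mode_gain i.
Proof. exact: sqr_ge0. Qed.

Lemma mode_den_gt0 b i : 0 < 1 + sD2^-1 * sR2 * mode_gain i * b 0 i ^+ 2.
Proof.
rewrite ltr_wpDr // mulr_ge0 ?sqr_ge0 // mulr_ge0 ?mode_gain_ge0 //.
by rewrite mulr_ge0 ?invr_ge0 // ltW.
Qed.

(** Each received covariance is at least the noise [sR2], so every factor is at least 1. This keeps
    the rate nonnegative and [ln] away from its singularity. *)
Lemma mode_sinr_ge1 g b : 1 <= mode_sinr g b.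
Proof.
rewrite -[leLHS](@big1_eq R 1 *%R 'I_NR (index_enum _) xpredT).
apply: ler_prod => i _; rewrite ler01 ler_pdivlMr ?mode_den_gt0 // mul1r lerD2l.
have -> : sD2^-1 * sR2 * mode_gain i * b 0 i ^+ 2 =
          sD2^-1 * mode_gain i * b 0 i ^+ 2 * sR2 by ring.
rewrite [leRHS]mulrA ler_wpM2l //; last first.
  by rewrite lerDr sumr_ge0 // => j _; rewrite mulr_ge0 // sqr_ge0.
by rewrite mulr_ge0 ?sqr_ge0 // mulr_ge0 ?mode_gain_ge0 // invr_ge0 ltW.
Qed.

Lemma mode_source_power_ge0 g : 0 <= mode_source_power g.
Proof. by rewrite sumr_ge0 // => j _; rewrite sqr_ge0. Qed.

Lemma mode_relay_power_ge0 g b : 0 <= mode_relay_power g b.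
Proof. by rewrite sumr_ge0 // => i _; rewrite mulr_ge0 ?sqr_ge0 // ltW // mode_cov_gt0. Qed.

Lemma mode_source_powerC g : (mode_source_power g)%:C = \sum_j (g 0 j ^+ 2)%:C.
Proof. exact: rmorph_sum. Qed.

Lemma mode_relay_powerC g b : (mode_relay_power g b)%:C =
  \sum_i (b 0 i ^+ 2)%:C * (\sum_j LH i j ^+ 2 * (g 0 j ^+ 2)%:C + sR2%:C).
Proof.
rewrite rmorph_sum; apply: eq_bigr => i _.
by rewrite rmorphM -mode_covC.
Qed.

Lemma mode_sinrC g b : (mode_sinr g b)%:C =
  \prod_i ((1 + (sD2%:C)^-1 * (\sum_j LG j i) ^+ 2 *
              ((b 0 i ^+ 2)%:C * (\sum_j LH i j ^+ 2 * (g 0 j ^+ 2)%:C + sR2%:C))) /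
           (1 + (sD2%:C)^-1 * sR2%:C * (\sum_j LG j i) ^+ 2 * (b 0 i ^+ 2)%:C)).
Proof.
rewrite rmorph_prod; apply: eq_bigr => i _.
rewrite -mode_covC -mode_gainC.
generalize (mode_gain i) (mode_cov g i) => k y.
rewrite fmorph_div !rmorphD !rmorph1 !rmorphM fmorphV /=.
by [].
Qed.

Lemma source_power_diag g : source_power (source_mx g) = mode_source_power g.
Proof.
rewrite /source_power mxtrace_diag.
have -> : \sum_j (\row_j (g 0 j ^+ 2)%:C) 0 j = (mode_source_power g)%:C.
  by rewrite mode_source_powerC; apply: eq_bigr => j _; rewrite mxE.
by [].
Qed.

Lemma relay_power_diag g b : (forall i, 0 <= b 0 i) ->
  relay_power LH sR2 (source_mx g) (relay_mx b) = mode_relay_power g b.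
Proof.
move=> b_ge0; rewrite -[RHS]/(complex.Re (mode_relay_power g b)%:C) mode_relay_powerC.
congr (complex.Re _).
rewrite (received_cov_diag _ _ LHd) relay_cov_diag => [|i]; last by rewrite mxE lecR.
rewrite mxtrace_diag; apply: eq_bigr => i _; rewrite !mxE rmorphXn.
by congr (_ * (_ + _)); apply: eq_bigr => j _; rewrite mxE.
Qed.

Lemma rate_diag g b : (forall i, 0 <= b 0 i) ->
  rate LH LG sR2 sD2 (source_mx g) (relay_mx b) = ln (mode_sinr g b).
Proof.
move=> b_ge0; rewrite (rateE _ _ _ _ sR2_gt0 sD2_gt0).
rewrite -[mode_sinr g b]/(complex.Re (mode_sinr g b)%:C) mode_sinrC.
congr (ln (complex.Re _)).
rewrite (sinr_ratio_diag _ _ _ LHd LGd) => [|i]; last by rewrite mxE lecR.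
apply: eq_bigr => i _; rewrite mxE -rmorphXn.
have -> : \sum_j LH i j ^+ 2 * (\row_j0 (g 0 j0 ^+ 2)%:C) 0 j =
  \sum_j LH i j ^+ 2 * (g 0 j ^+ 2)%:C by apply: eq_bigr => j _; rewrite mxE.
by [].
Qed.

Lemma mode_dominates (Q : 'M[R[i]]_NS) (A : 'M[R[i]]_NR) :
  decreasing_diag LH -> decreasing_diag LG -> psdmx Q ->
  exists g b, [/\ (forall j, 0 <= g 0 j) /\ (forall i, 0 <= b 0 i),
    mode_source_power g <= source_power Q,
    mode_relay_power g b <= relay_power LH sR2 Q A
    & rate LH LG sR2 sD2 Q A <= ln (mode_sinr g b)].
Proof.
move=> LH_decr LG_decr Qp.
have r_gt0 : 0 < sR2%:C :> R[i] by rewrite ltcR.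
have s_gt0 : 0 < sD2%:C :> R[i] by rewrite ltcR.
have [q [al [[q_ge0 al_ge0] q_sum al_sum ratio_gt0 ratio_le]]] :=
  sinr_ratio_le_diag A LHd LH_decr LGd LG_decr Qp r_gt0 s_gt0.
(* Powers become amplitudes, since both [g] and [b] enter the mode formulas through their
   squares. *)
pose g : 'rV[R]_NS := \row_j Num.sqrt (complex.Re (q 0 j)).
pose b : 'rV[R]_NR := \row_i Num.sqrt (complex.Re (al 0 i)).
have gE j : (g 0 j ^+ 2)%:C = q 0 j.
  by rewrite mxE sqr_sqrtr ?ReK // -lecR ReK.
have bE i : (b 0 i ^+ 2)%:C = al 0 i.
  by rewrite mxE sqr_sqrtr ?ReK // -lecR ReK.
have yE i : \sum_j LH i j ^+ 2 * (g 0 j ^+ 2)%:C + sR2%:C =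
    \sum_j LH i j ^+ 2 * q 0 j + sR2%:C.
  by congr (_ + _); apply: eq_bigr => j _; rewrite gE.
have le_Re (x : R) (z : R[i]) : x%:C <= z -> x <= complex.Re z.
  by rewrite lecE => /andP[].
exists g, b; split.
- by split=> i; rewrite mxE sqrtr_ge0.
- apply: le_Re; rewrite mode_source_powerC.
  by under eq_bigr do rewrite gE.
- apply: le_Re; rewrite mode_relay_powerC.
  by under eq_bigr do rewrite bE yE.
rewrite (rateE _ _ _ _ sR2_gt0 sD2_gt0).
have ratio_le' : sinr_ratio LH LG sR2%:C sD2%:C Q A <= (mode_sinr g b)%:C.
  rewrite mode_sinrC.
  under eq_bigr do rewrite bE yE.
  exact: ratio_le.
move: ratio_gt0 ratio_le'; move: (sinr_ratio _ _ _ _ _ _) => z.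
rewrite ltcE lecE => /andP[_ z_gt0] /andP[_ z_le].
by rewrite ler_ln // posrE // (lt_le_trans z_gt0).
Qed.

End DiagonalProblem.

(** * Existence of an optimal mode allocation *)

Section ModeOptimum.
Variables (R : realType) (NS NR ND : nat).
Variables (LH : 'M[R[i]]_(NR, NS)) (LG : 'M[R[i]]_(ND, NR)) (sR2 sD2 Pc Rmin PSmax PRmax : R).
Hypotheses (sR2_gt0 : 0 < sR2) (sD2_gt0 : 0 < sD2) (Pc_gt0 : 0 < Pc).

Let T : topologicalType := ('rV[R]_NS * 'rV[R]_NR)%type.

(** Amplitudes are kept nonnegative because [b] is to provide the singular values of the relay
    matrix. *)
Definition mode_feasible (g : 'rV[R]_NS) (b : 'rV[R]_NR) : Prop :=
  [/\ (forall j, 0 <= g 0 j) /\ (forall i, 0 <= b 0 i),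
      Rmin <= ln (mode_sinr LH LG sR2 sD2 g b),
      mode_source_power g <= PSmax
    & mode_relay_power LH sR2 g b <= PRmax].

Definition mode_efficiency (g : 'rV[R]_NS) (b : 'rV[R]_NR) : R :=
  ln (mode_sinr LH LG sR2 sD2 g b) /
  (mode_source_power g + mode_relay_power LH sR2 g b + Pc).

Let continuous_g j : continuous (fun p : T => p.1 0 j).
Proof.
move=> p; apply: (@continuous_comp _ _ _ fst (fun v : 'rV[R]_NS => v 0 j)).
  exact: cvg_fst.
exact: coord_continuous.
Qed.

Let continuous_b i : continuous (fun p : T => p.2 0 i).
Proof.
move=> p; apply: (@continuous_comp _ _ _ snd (fun v : 'rV[R]_NR => v 0 i)).
  exact: cvg_snd.
exact: coord_continuous.
Qed.

Let continuous_const (c : R) : continuous (fun _ : T => c).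
Proof. by move=> p; exact: cvg_cst. Qed.

Let continuous_add (f1 f2 : T -> R) :
  continuous f1 -> continuous f2 -> continuous (fun p => f1 p + f2 p).
Proof. by move=> c1 c2 p; apply: continuousD; [exact: c1|exact: c2]. Qed.

Let continuous_mul (f1 f2 : T -> R) :
  continuous f1 -> continuous f2 -> continuous (fun p => f1 p * f2 p).
Proof. by move=> c1 c2 p; apply: continuousM; [exact: c1|exact: c2]. Qed.

Let continuous_div (f1 f2 : T -> R) : (forall p, f2 p != 0) ->
  continuous f1 -> continuous f2 -> continuous (fun p => f1 p / f2 p).
Proof.
move=> f20 c1 c2; apply: continuous_mul => // p.
by apply: continuousV => //; exact: c2.
Qed.

Let continuous_sum n (f : 'I_n -> T -> R) :
  (forall i, continuous (f i)) -> continuous (fun p => \sum_i f i p).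
Proof. by move=> cf; apply: (continuous_big (@add_continuous R)) => i _; exact: cf. Qed.

Let continuous_prod n (f : 'I_n -> T -> R) :
  (forall i, continuous (f i)) -> continuous (fun p => \prod_i f i p).
Proof. by move=> cf; apply: (continuous_big (@mul_continuous R)) => i _; exact: cf. Qed.

Let continuous_sqr (f : T -> R) : continuous f -> continuous (fun p => f p ^+ 2).
Proof. by move=> cf; apply: continuous_mul. Qed.

Let continuous_mode_cov i : continuous (fun p : T => mode_cov LH sR2 p.1 i).
Proof.
apply: continuous_add => //; apply: continuous_sum => j; apply: continuous_mul => //.
exact/continuous_sqr.
Qed.

Let continuous_source_power : continuous (fun p : T => mode_source_power p.1).
Proof. by apply: continuous_sum => j; exact: continuous_sqr. Qed.

Let continuous_relay_power : continuous (fun p : T => mode_relay_power LH sR2 p.1 p.2).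
Proof. by apply: continuous_sum => i; apply: continuous_mul => //; exact: continuous_sqr. Qed.

Let continuous_ln_sinr : continuous (fun p : T => ln (mode_sinr LH LG sR2 sD2 p.1 p.2)).
Proof.
move=> p.
apply: (@continuous_comp _ _ _ (fun p : T => mode_sinr LH LG sR2 sD2 p.1 p.2) (@ln R));
  last first.
  apply: continuous_ln; exact: lt_le_trans (mode_sinr_ge1 _ _ _ _ _ _).
move: p; apply: continuous_prod => i; apply: continuous_div => [p||].
- by rewrite gt_eqF // mode_den_gt0.
- apply: continuous_add => //; apply: continuous_mul => //.
  by apply: continuous_mul => //; exact: continuous_sqr.
- apply: continuous_add => //; apply: continuous_mul => //.
  exact: continuous_sqr.
Qed.

(** The power limits confine the feasible amplitudes to a compact box, in which the remaining
    constraints are closed; the extreme value theorem applies to the continuous efficiency. *)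
Lemma mode_optimum : (exists g b, mode_feasible g b) ->
  exists g b, mode_feasible g b /\
    forall g' b', mode_feasible g' b' -> mode_efficiency g' b' <= mode_efficiency g b.
Proof.
move=> [g0 [b0 gb0]].
(* The relay bound divides by [sR2] because each mode of the received covariance carries at least
   that power. Adding 1 turns a bound on a square into a bound on its root. *)
pose B := PSmax + 1; pose B' := PRmax / sR2 + 1.
pose box : set T := ([set g : 'rV[R]_NS | forall j, `[0, B]%classic (g 0 j)] `*`
            [set b : 'rV[R]_NR | forall i, `[0, B']%classic (b 0 i)])%classic.
pose F : set T := ([set p | Rmin <= ln (mode_sinr LH LG sR2 sD2 p.1 p.2)] `&`
  ([set p | mode_source_power p.1 <= PSmax] `&`
   [set p | mode_relay_power LH sR2 p.1 p.2 <= PRmax]))%classic.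
have le_sqr_bound (x M : R) : 0 <= x -> x ^+ 2 <= M -> x <= M + 1.
  by move=> x_ge0 xM; have := sqr_ge0 (x - 1); rewrite sqrrB1; lra.
have mode_box g b : mode_feasible g b -> (box `&` F)%classic (g, b).
  move=> [[g_ge0 b_ge0] rate_ge sp_le rp_le]; split=> //; split=> /=.
    move=> j /=; rewrite in_itv /= g_ge0 /=; apply: le_sqr_bound => //.
    apply: le_trans sp_le; rewrite /mode_source_power (bigD1 j) //= lerDl.
    by rewrite sumr_ge0 // => j' _; rewrite sqr_ge0.
  move=> i /=; rewrite in_itv /= b_ge0 /=; apply: le_sqr_bound => //.
  rewrite ler_pdivlMr //; apply: le_trans rp_le.
  rewrite /mode_relay_power (bigD1 i) //= ler_wpDr //.
    by rewrite sumr_ge0 // => i' _; rewrite mulr_ge0 ?sqr_ge0 // ltW // mode_cov_gt0.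
  by rewrite ler_wpM2l ?sqr_ge0 // lerDr sumr_ge0 // => j _; rewrite mulr_ge0 // sqr_ge0.
have box_mode g b : (box `&` F)%classic (g, b) -> mode_feasible g b.
  move=> [[/= g_box b_box] [rate_ge [sp_le rp_le]]]; split=> //; split=> i.
    by have := g_box i; rewrite /= in_itv /= => /andP[].
  by have := b_box i; rewrite /= in_itv /= => /andP[].
have closed_F : closed F.
  apply: closedI; last apply: closedI.
  - exact: ((continuous_closedP _).1 continuous_ln_sinr _ (@closed_ge R Rmin)).
  - exact: ((continuous_closedP _).1 continuous_source_power _ (@closed_le R PSmax)).
  - exact: ((continuous_closedP _).1 continuous_relay_power _ (@closed_le R PRmax)).
have compact_box : compact box.
  apply: compact_setX.
    exact: (@rV_compact R NS (fun=> `[0, B]%classic) (fun=> @segment_compact R 0 B)).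
  exact: (@rV_compact R NR (fun=> `[0, B']%classic) (fun=> @segment_compact R 0 B')).
have cont_eff : continuous (fun p : T => mode_efficiency p.1 p.2).
  apply: continuous_div => [p||]; last 2 first.
  - exact: continuous_ln_sinr.
  - by apply: continuous_add => //; exact: continuous_add.
  rewrite gt_eqF // ltr_wpDl // addr_ge0 //; first exact: mode_source_power_ge0.
  exact: mode_relay_power_ge0.
have [] := @compact_EVT_max T R (fun p => mode_efficiency p.1 p.2) (box `&` F)%classic.
- by exists (g0, b0); exact: mode_box.
- exact: compact_closedI.
- exact: continuous_subspaceT.
move=> [g b]; rewrite inE => gb_in gb_max; exists g, b; split; first exact: box_mode.
by move=> g' b' gb'; have := gb_max (g', b'); rewrite inE; apply; exact: mode_box.
Qed.

End ModeOptimum.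

(** * Optimality of the aligned singular bases *)

(** The numerators are compared first, over the larger denominator; then the denominator shrinks
    under the nonnegative mode rate. This order leaves the sign of [r] free. *)
Lemma mode_efficiency_ge (R : realType) NS NR ND (LH : 'M[R[i]]_(NR, NS))
    (LG : 'M[R[i]]_(ND, NR)) (sR2 sD2 Pc r sp rp : R) g b :
  0 < sR2 -> 0 < sD2 -> 0 < Pc ->
  r <= ln (mode_sinr LH LG sR2 sD2 g b) ->
  mode_source_power g <= sp -> mode_relay_power LH sR2 g b <= rp ->
  r / (sp + rp + Pc) <= mode_efficiency LH LG sR2 sD2 Pc g b.
Proof.
move=> sR2_gt0 sD2_gt0 Pc_gt0 r_le sp_le rp_le; rewrite /mode_efficiency.
have rate_ge0 : 0 <= ln (mode_sinr LH LG sR2 sD2 g b) by rewrite ln_ge0 // mode_sinr_ge1.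
have den_gt0 : 0 < mode_source_power g + mode_relay_power LH sR2 g b + Pc.
  by rewrite ltr_wpDl // addr_ge0 ?mode_source_power_ge0 ?mode_relay_power_ge0.
have den_le : mode_source_power g + mode_relay_power LH sR2 g b + Pc <= sp + rp + Pc.
  by rewrite lerD2r lerD.
have den_gt0' := lt_le_trans den_gt0 den_le.
apply: le_trans (_ : ln (mode_sinr LH LG sR2 sD2 g b) / (sp + rp + Pc) <= _).
  by rewrite ler_wpM2r // invr_ge0 ltW.
by rewrite ler_wpM2l // lef_pV2.
Qed.

Theorem proposition1 (R : realType) (NS NR ND : nat)
    (H : 'M[R[i]]_(NR, NS)) (G : 'M[R[i]]_(ND, NR))
    (sR2 sD2 Pc Rmin PSmax PRmax : R)
    (sR2_gt0 : 0 < sR2) (sD2_gt0 : 0 < sD2) (Pc_gt0 : 0 < Pc)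
    (Rmin_ge0 : 0 <= Rmin) (PSmax_gt0 : 0 < PSmax) (PRmax_gt0 : 0 < PRmax)
    (UH : 'M[R[i]]_NR) (LH : 'M[R[i]]_(NR, NS)) (VH : 'M[R[i]]_NS)
    (UG : 'M[R[i]]_ND) (LG : 'M[R[i]]_(ND, NR)) (VG : 'M[R[i]]_NR)
    (svdH : is_svd H UH LH VH) (decrH : decreasing_diag LH)
    (svdG : is_svd G UG LG VG) (decrG : decreasing_diag LG)
    (feas : exists (Q : 'M[R[i]]_NS) (A : 'M[R[i]]_NR),
        feasible H G sR2 sD2 Rmin PSmax PRmax Q A) :
  exists (Q UQ LQ : 'M[R[i]]_NS) (A UA LA VA : 'M[R[i]]_NR),
    [/\ optimal H G sR2 sD2 Pc Rmin PSmax PRmax Q A,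
        is_evd Q UQ LQ,
        is_svd A UA LA VA
      & [/\ UQ = VH, UA = VG & VA = UH]].
Proof.
case: svdH => UHU VHU LHd HE; case: svdG => UGU VGU LGd GE.
(* In the singular bases of the channels both hops are diagonal, and rates and powers are unchanged,
   so the mode bound holds for arbitrary [Q] and [A]. *)
have dominated (Q : 'M[R[i]]_NS) (A : 'M[R[i]]_NR) : psdmx Q ->
    exists (g : 'rV[R]_NS) (b : 'rV[R]_NR),
    [/\ (forall j, 0 <= g 0 j) /\ (forall i, 0 <= b 0 i),
      mode_source_power g <= source_power Q,
      mode_relay_power LH sR2 g b <= relay_power H sR2 Q A
      & rate H G sR2 sD2 Q A <= ln (mode_sinr LH LG sR2 sD2 g b)].
  move=> Qp; pose Q' := VH ^t* *m Q *m VH; pose A' := VG ^t* *m A *m UH.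
  have QE : Q = VH *m Q' *m VH ^t*.
    by rewrite /Q' !mulmxA (unitarymxP VHU) mul1mx mulmxtVK.
  have AE : A = VG *m A' *m UH ^t*.
    by rewrite /A' !mulmxA (unitarymxP VGU) mul1mx mulmxtVK.
  have Qp' : psdmx Q' by have := psdmx_conj (VH ^t*) Qp; rewrite trmxCK.
  have [g [b [gb_ge0 sp_le rp_le rate_le]]] :=
    mode_dominates sR2_gt0 sD2_gt0 LHd LGd A' decrH decrG Qp'.
  exists g, b; split; first exact: gb_ge0.
  - by rewrite QE source_power_unitary.
  - by rewrite HE QE AE relay_power_unitary.
  - by rewrite HE GE QE AE rate_unitary.
have [g [b [gb_feas gb_max]]] :
    exists g b, mode_feasible LH LG sR2 sD2 Rmin PSmax PRmax g b /\
    forall g' b', mode_feasible LH LG sR2 sD2 Rmin PSmax PRmax g' b' ->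
      mode_efficiency LH LG sR2 sD2 Pc g' b' <= mode_efficiency LH LG sR2 sD2 Pc g b.
  apply: mode_optimum => //.
  (* The modes dominating a feasible pair are feasible: their rate is no smaller and their powers no
     larger. *)
  have [Q [A [Qp rate_ge sp_le rp_le]]] := feas.
  have [g [b [gb_ge0 sp rp rt]]] := dominated Q A Qp.
  exists g, b; split; [exact: gb_ge0 | exact: le_trans rt | exact: le_trans sp_le
    | exact: le_trans rp_le].
have [[g_ge0 b_ge0] rate_ge sp_le rp_le] := gb_feas.
have g2_ge0 j : 0 <= (\row_j (g 0 j ^+ 2)%:C : 'rV[R[i]]_NS) 0 j.
  by rewrite mxE lecR sqr_ge0.
(* The optimal modes are rotated back into the singular bases, which fixes the unitary factors as
   required. *)
pose Q := VH *m source_mx g *m VH ^t*; pose A := VG *m relay_mx b *m UH ^t*.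
have spE : source_power Q = mode_source_power g.
  by rewrite -(source_power_diag g); exact: source_power_unitary.
have rpE : relay_power H sR2 Q A = mode_relay_power LH sR2 g b.
  by rewrite -(relay_power_diag sR2 LHd g b_ge0) HE; exact: relay_power_unitary.
have rtE : rate H G sR2 sD2 Q A = ln (mode_sinr LH LG sR2 sD2 g b).
  by rewrite -(rate_diag sR2_gt0 sD2_gt0 LHd LGd g b_ge0) HE GE; exact: rate_unitary.
exists Q, VH, (source_mx g), A, VG, (relay_mx b), UH; split.
- split.
    split; [|by rewrite rtE|by rewrite spE|by rewrite rpE].
    exact/psdmx_conj/psdmx_diag.
  move=> Q' A' [Qp' rate_ge' sp_le' rp_le'].
  have [g' [b' [gb_ge0' sp' rp' rt']]] := dominated Q' A' Qp'.
  (* Any competitor is at most as efficient as the feasible modes dominating it, and these are at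
     most as efficient as the optimal modes. *)
  apply: le_trans (_ : mode_efficiency LH LG sR2 sD2 Pc g' b' <= _).
    exact: mode_efficiency_ge.
  rewrite [leRHS]/energy_efficiency spE rpE rtE; apply: gb_max.
  split; [exact: gb_ge0' | exact: le_trans rt' | exact: le_trans sp_le'
    | exact: le_trans rp_le'].
- split=> //; split; first exact: diag_mx_is_diag.
  by move=> i j; rewrite mxE; case: eqP => _; rewrite ?mulr1n ?mulr0n.
- split=> //; split; first exact: diag_mx_is_diag.
  by move=> i j; rewrite mxE; case: eqP => _; rewrite ?mulr1n ?mulr0n // mxE lecR.
- by [].
Qed.
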